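(* Fix an integer $k \ge 3$. For each $N$ let $\Omega = [N]$ (for all $N$) or $\Omega = \mathbb{Z}/N\mathbb{Z}$ (for all $N$). Let $p = p_N \in (0,1)$ be bounded away from $1$, and let $\delta = \delta_N > 0$ with $\delta = O(1)$ be such that $$\min\{\delta p^k, \delta^2 p\} \ge N^{-\frac{1}{6(k-1)}} \log N .$$ Then, as $N \to \infty$, $$-\log \mathbb{P}\big(T_k(\Omega_p) \ge (1+\delta)\,\mathbb{E}\, T_k(\Omega_p)\big) = (1+o(1))\,\phi_p^{(k,\Omega)}(\delta + o(\delta)).$$ Furthermore, for $k=3$ the right-hand side of the displayed hypothesis can be relaxed to $N^{-1/6}(\log N)^{7/6}$, and for $k=4$ it can be relaxed to $N^{-1/12}(\log N)^{13/12}$ (i.e. the same conclusion holds under the hypothesis with this right-hand side).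
   Context: $[N]=\{1,\dots,N\}$. The ambient group is $\mathbb{Z}$ if $\Omega=[N]$ and $\mathbb{Z}/N\mathbb{Z}$ if $\Omega=\mathbb{Z}/N\mathbb{Z}$. For a subset $A$ of the ambient group, $T_k(A)$ is the number of pairs $(a,b)$ of elements of the ambient group with $a,a+b,\dots,a+(k-1)b\in A$ (so $b=0$ and negative differences are allowed). For $f:\Omega\to\mathbb{R}$, $T_k(f)=\sum_{a,b} f(a)f(a+b)\cdots f(a+(k-1)b)$, the sum over pairs $(a,b)$ in the ambient group with $\{a,a+b,\dots,a+(k-1)b\}\subset\Omega$. $\Omega_p$ is the random subset of $\Omega$ including each element independently with probability $p$. $I_p(x)=x\log\frac{x}{p}+(1-x)\log\frac{1-x}{1-p}$ for $x\in[0,1]$ (with $0\log 0=0$), and $$\phi_p^{(k,\Omega)}(\delta)=\inf_{f:\Omega\to[0,1]}\Big\{\sum_{a\in\Omega}I_p(f(a)) : T_k(f)\ge(1+\delta)p^kT_k(\Omega)\Big\}$$ (infimum of the empty set is $+\infty$, and $-\log 0=+\infty$). Meaning of the asymptotic conclusion: there is a sequence $\varepsilon_N\to0$, $\varepsilon_N \ge 0$, such that for all large $N$ the left-hand side lies between $(1-\varepsilon_N)\phi_p^{(k,\Omega)}((1-\varepsilon_N)\delta)$ and $(1+\varepsilon_N)\phi_p^{(k,\Omega)}((1+\varepsilon_N)\delta)$. *)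

(* Defs.v *)
From HB Require Import structures.
From mathcomp Require Import all_boot all_order all_algebra finmap.
From mathcomp Require Import all_classical all_reals all_analysis.
Set Implicit Arguments.
Unset Strict Implicit.
Unset Printing Implicit Defensive.
Import Order.TTheory GRing.Theory Num.Theory.
Import numFieldNormedType.Exports.
Local Open Scope fset_scope.
Local Open Scope classical_set_scope.
Local Open Scope ring_scope.

Inductive setting := IntegerInterval | CyclicGroup.

(* [Z/NZ] is ['I_N.-1.+1], which has exactly [N] elements for every [N >= 1],
   unlike ['Z_N], which is [Z/2Z] when [N = 1]. *)
Definition ambient (S : setting) (N : nat) : zmodType :=
  match S with
  | IntegerInterval => int
  | CyclicGroup => 'I_N.-1.+1
  end.

Definition Omega (S : setting) (N : nat) : {fset ambient S N} :=
  match S return {fset ambient S N} with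
  | IntegerInterval => [fset Posz i | i in iota 1 N]
  | CyclicGroup => [fset x | x in 'I_N.-1.+1]
  end.

Section ArithmeticProgressions.
Context {R : realType} {G : zmodType}.
Implicit Types (A B : {fset G}) (f : G -> R).

Definition APs (k : nat) A : set (G * G) :=
  [set ab | forall i : nat, (i < k)%N -> ab.1 + ab.2 *+ i \in A].

(* Both [fset_set] and [\sum_(_ \in _)] return a default value on infinite
   sets; [APs k A] is finite as soon as [2 <= k]. *)
Definition Tset (k : nat) A : nat := #|` fset_set (APs k A)|.

(* A function on [A] is represented by a function on the whole group; only its
   values on [A] matter, here and in [phi] below. *)
Definition Tfun (k : nat) A f : R :=
  \sum_(ab \in APs k A) \prod_(i < k) f (ab.1 + ab.2 *+ i).

(* Probability that the random subset of [A] containing each element of [A]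
   independently with probability [p] equals [B], for [B] a subset of [A]. *)
Definition random_subset_law (p : R) A B : R :=
  \prod_(a <- A) (if a \in B then p else 1 - p).

Definition random_subset_Pr (p : R) A (E : pred {fset G}) : R :=
  \sum_(B <- fpowerset A | E B) random_subset_law p A B.

Definition random_subset_Ex (p : R) A (X : {fset G} -> R) : R :=
  \sum_(B <- fpowerset A) random_subset_law p A B * X B.

(* [0 log 0 = 0] holds because [ln 0 = 0]. *)
Definition relative_entropy (p x : R) : R :=
  x * ln (x / p) + (1 - x) * ln ((1 - x) / (1 - p)).

Definition phi (k : nat) A (p delta : R) : \bar R :=
  ereal_inf [set (\sum_(a <- A) relative_entropy p (f a))%:E | f in
    [set f : G -> R | (forall a, a \in A -> 0 <= f a <= 1) /\
      (1 + delta) * p ^+ k * (Tset k A)%:R <= Tfun k A f]].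

(* [lne 0 = -oo] *)
Definition upper_tail_rate (k : nat) A (p delta : R) : \bar R :=
  (- lne (random_subset_Pr p A (fun B =>
     (1 + delta) * random_subset_Ex p A (fun C => (Tset k C)%:R)
       <= (Tset k B)%:R))%:E)%E.

End ArithmeticProgressions.

(* The meaning given to
   [-log P(T_k(Omega_p) >= (1 + delta) E T_k(Omega_p))
     = (1 + o(1)) phi_p(delta + o(delta))] as [N --> oo]. *)
Definition upper_tail_asymptotics {R : realType} (S : setting) (k : nat)
    (p delta : nat -> R) : Prop :=
  exists eps : nat -> R,
    [/\ eps @ \oo --> (0 : R),
        (forall N, 0 <= eps N) &
        \forall N \near \oo,
          ((1 - eps N)%:E * phi k (Omega S N) (p N) ((1 - eps N) * delta N)
             <= upper_tail_rate k (Omega S N) (p N) (delta N)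
             <= (1 + eps N)%:E
                  * phi k (Omega S N) (p N) ((1 + eps N) * delta N))%E].

(* Main.v *)
(** The proof replaces the nonlinear large deviation machinery by an entropic
    covering argument. Encode a random subset by a 0-1 vector [x].

    Upper bound on the tail probability. If the upper tail event is split into
    [M] pieces, one of them has probability at least [P(E) / M]; the law of [x]
    conditioned on this piece has some mean [y], and subadditivity of entropy
    gives [sum_a I_p(y_a) <= - log P(E) + log M]. It remains to choose the pieces
    so that [T_k(y) >= T_k(x) - o(delta p^k N^2)] for [x] in the piece. Replacing
    [x] by [y] one factor at a time, it is enough that all points of a piece have
    almost the same correlation with every dual function
    [a |-> N^-1 sum prod_(j <> i) f_j], where [a] is the [i]-th term of the
    progression. Greedy energy decrement approximates [x], for this purpose, by a
    sum of [O(eps^-2)] members of a dictionary [D], whence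
    [log M = O(eps^-2 log |D|)]. In general [D] consists of dual functions of
    random samples of size about [N^(1-1/(k-1))], so that [log |D|] is about
    [N^(1-1/(k-1)) log N]; for [k = 3], the form is diagonalized by characters and
    [D] has [O(N)] elements. As [phi_p(delta)] is at least of order
    [(delta p^k)^2 N] by Pinsker's inequality, [log M] is negligible.

    Lower bound. Sample [x] from the product law with marginals [f], for [f]
    feasible with [(1 + eta) delta] in place of [delta]. Chebyshev's inequality
    shows that the upper tail event has probability close to [1] under this law,
    and data processing for relative entropy bounds its original probability. *)

Require Import Defs.
From HB Require Import structures.
From mathcomp Require Import all_boot all_order all_algebra finmap.
From mathcomp Require Import all_classical all_reals all_analysis.
From mathcomp Require Import lra ring zify complex cyclic cyclotomic separable.
Set Implicit Arguments.
Unset Strict Implicit.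
Unset Printing Implicit Defensive.
Import Order.TTheory GRing.Theory Num.Theory.
Import numFieldNormedType.Exports.
Local Open Scope classical_set_scope.
Local Open Scope ring_scope.

Lemma ln_le_subr1 {R : realType} (u : R) : 0 < u -> ln u <= u - 1.
Proof.
move=> u0; have := @le_ln1Dx R (u - 1).
by rewrite (_ : 1 + (u - 1) = u); [apply; lra | ring].
Qed.

(** * Product measures and relative entropy *)

Section ProductWeights.
Context {R : realType} {J A : finType}.
Implicit Types (w : J -> A -> R) (s : {ffun J -> A}).

(** Instantiated for random bits indexed by points, for the [m] draws of a sample, and for one
    sample per position of a form. *)
Definition prod_weight w s : R := \prod_j w j (s j).

Lemma prod_weight_ge0 w s : (forall j a, 0 <= w j a) -> 0 <= prod_weight w s.
Proof. by move=> w0; apply: prodr_ge0. Qed.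

Lemma sum_prod_weight_prod w (g : J -> A -> R) :
  \sum_s prod_weight w s * \prod_j g j (s j) = \prod_j \sum_a w j a * g j a.
Proof. by rewrite bigA_distr_bigA; apply: eq_bigr => s _; rewrite big_split. Qed.

Section Normalized.
Variable w : J -> A -> R.
Hypothesis w1 : forall j, \sum_a w j a = 1.

Lemma sum_prod_weight : \sum_s prod_weight w s = 1.
Proof. by rewrite -bigA_distr_bigA big1. Qed.

Lemma sum_prod_weight_prod_in (D : pred J) (g : J -> A -> R) :
  \sum_s prod_weight w s * \prod_(j | D j) g j (s j)
    = \prod_(j | D j) \sum_a w j a * g j a.
Proof.
transitivity (\sum_s prod_weight w s * \prod_j (if D j then g j (s j) else 1)).
  by apply: eq_bigr => s _; rewrite [X in _ * X]big_mkcond.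
rewrite (sum_prod_weight_prod w (fun j a => if D j then g j a else 1)).
rewrite [RHS]big_mkcond /=; apply: eq_bigr => j _; case: (D j) => //.
by under eq_bigr do rewrite mulr1; exact: w1.
Qed.

Lemma sum_prod_weight_marginal j (g : A -> R) :
  \sum_s prod_weight w s * g (s j) = \sum_a w j a * g a.
Proof.
have := sum_prod_weight_prod_in (pred1 j) (fun=> g).
by rewrite big_pred1_eq => <-; apply: eq_bigr => s _; rewrite big_pred1_eq.
Qed.

Lemma sum_prod_weight_marginal2 i j (g h : A -> R) : i != j ->
  \sum_s prod_weight w s * (g (s i) * h (s j))
    = (\sum_a w i a * g a) * (\sum_a w j a * h a).
Proof.
move=> ij; have ji : j == i = false by rewrite eq_sym (negbTE ij).
pose G l := if l == i then g else h.
have E F : \prod_(l | (l == i) || (l == j)) F l = F i * F j :> R.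
  rewrite (bigD1 i) ?eqxx//=; congr *%R; rewrite (big_pred1 j)// => l /=.
  by case: (eqVneq l i) => [->|]; rewrite ?andbT ?andbF//= eq_sym ?ji.
have := sum_prod_weight_prod_in (fun l => (l == i) || (l == j)) G.
rewrite E {2 3}/G eqxx ji => <-.
by apply: eq_bigr => s _; rewrite E /G eqxx ji.
Qed.

End Normalized.
End ProductWeights.

Section RandomSubset.
Context {R : realType} {I : finType}.
Implicit Types (r y : I -> R) (x : {ffun I -> bool}) (E : pred {ffun I -> bool}).

Definition bern r (a : I) (b : bool) : R := if b then r a else 1 - r a.

Lemma sum_bern r a : \sum_b bern r a b = 1.
Proof. by rewrite big_bool /= /bern; lra. Qed.

Lemma bern_ge0 r a b : (forall a, 0 <= r a <= 1) -> 0 <= bern r a b.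
Proof. by move=> /(_ a) ?; rewrite /bern; case: b; lra. Qed.

Definition bern_Pr r E : R := \sum_(x | E x) prod_weight (bern r) x.

Definition entropy (p : R) y : R := \sum_a relative_entropy p (y a).

(* The logarithm of the likelihood ratio of [bern y] and [bern p]; it is affine
   in [x], so averaging it replaces [x] by its mean. *)
Definition log_ratio (p : R) y x : R :=
  \sum_a ((x a)%:R * ln (y a / p) + (1 - (x a)%:R) * ln ((1 - y a) / (1 - p))).

(** When the weight of [x] is nonzero every one-coordinate ratio is positive, and [ln] turns the
    product into a sum; elsewhere the convention [ln 0 = 0] can break the identity. *)
Lemma log_ratioE (p : R) y x : 0 < p < 1 -> (forall a, 0 <= y a <= 1) ->
  prod_weight (bern y) x != 0 ->
  log_ratio p y x = ln (prod_weight (bern y) x / prod_weight (bern (fun=> p)) x).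
Proof.
move=> p01 y01 /prodf_neq0 yx; rewrite /prod_weight -prodf_div /log_ratio.
have pos a : 0 < bern y a (x a) / bern (fun=> p) a (x a).
  rewrite divr_gt0//; first by rewrite lt_def yx// bern_ge0.
  by rewrite /bern; case: (x a); lra.
rewrite [RHS](_ : _ = \sum_a ln (bern y a (x a) / bern (fun=> p) a (x a))).
  apply: eq_bigr => a _; rewrite /bern; case: (x a) => /=.
    by rewrite subrr mul1r mul0r addr0.
  by rewrite subr0 mul1r mul0r add0r.
have : forall a, a \in index_enum I ->
    0 < bern y a (x a) / bern (fun=> p) a (x a).
  by move=> a _; exact: pos.
elim: (index_enum I) => [|a s IH] h; first by rewrite !big_nil ln1.
rewrite !big_cons -IH => [|b bs]; last by rewrite h// inE bs orbT.
by rewrite [LHS]lnM// posrE ?pos//; apply: prodr_gt0 => b _; exact: pos.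
Qed.

Lemma prod_weight_bern_gt0 (p : R) x : 0 < p < 1 ->
  0 < prod_weight (bern (fun=> p)) x.
Proof. by move=> p01; apply: prodr_gt0 => a _; rewrite /bern; case: (x a); lra. Qed.

Lemma entropy_mean (p : R) y (mu : {ffun I -> bool} -> R) :
  \sum_x mu x = 1 -> (forall a, \sum_x mu x * (x a)%:R = y a) ->
  \sum_x mu x * log_ratio p y x = entropy p y.
Proof.
move=> mu1 muy; under eq_bigr do rewrite /log_ratio mulr_sumr.
rewrite exchange_big /=; apply: eq_bigr => a _.
set b := ln _; set c := ln _; rewrite /relative_entropy -/b -/c.
transitivity (\sum_x (mu x * (x a)%:R * (b - c) + mu x * c)).
  by apply: eq_bigr => x _; ring.
by rewrite big_split /= -!mulr_suml mu1 muy; ring.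
Qed.

(* Gibbs' inequality for the conditional law on [E] against the product law with
   the same marginals. *)
Lemma entropy_le_conditional (p : R) E : 0 < p < 1 ->
  0 < bern_Pr (fun=> p) E ->
  let y a := (\sum_(x | E x) prod_weight (bern (fun=> p)) x * (x a)%:R)
               / bern_Pr (fun=> p) E in
  (forall a, 0 <= y a <= 1) /\ entropy p y <= - ln (bern_Pr (fun=> p) E).
Proof.
move=> p01; set Q := bern_Pr _ E; set P := prod_weight _ => Q0 y.
have P0 x : 0 < P x by exact: prod_weight_bern_gt0.
pose mu x := if E x then P x / Q else 0.
have mu0 x : 0 <= mu x by rewrite /mu; case: ifP => // _; rewrite divr_ge0 ?ltW.
have mu1 : \sum_x mu x = 1.
  by rewrite -big_mkcond -mulr_suml divff// gt_eqF.
have muy a : \sum_x mu x * (x a)%:R = y a.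
  rewrite /y mulr_suml [RHS]big_mkcond; apply: eq_bigr => x _; rewrite /mu.
  by case: ifP => _; rewrite ?mul0r// mulrAC.
have y01 a : 0 <= y a <= 1.
  rewrite -muy sumr_ge0 => [/=|x _]; last by rewrite mulr_ge0.
  by rewrite -[leRHS]mu1; apply: ler_sum => x _; rewrite ler_piMr//; case: (x a).
split=> //; rewrite -(entropy_mean p mu1 muy).
(* A point of [E] has positive conditional mass, so each of its coordinates takes a value that the
   marginal [y] charges. *)
have nu0 x : E x -> prod_weight (bern y) x != 0.
  move=> Ex; apply/prodf_neq0 => a _; have mux : 0 < mu x.
    by rewrite /mu Ex divr_gt0.
  have le1 : mu x <= \sum_x' mu x' * ((x' a) == x a)%:R.
    rewrite (bigD1 x)//= eqxx mulr1 lerDl sumr_ge0// => z _.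
    by rewrite mulr_ge0.
  have {}le1 := lt_le_trans mux le1.
  rewrite /bern; case: (x a) le1 => le1.
    rewrite -muy gt_eqF// (lt_le_trans le1)//; apply: ler_sum => z _.
    by case: (z a).
  rewrite -muy -{1}mu1 -sumrB gt_eqF//.
  rewrite (eq_bigr (fun x' => mu x' * (x' a == false)%:R))// => x' _.
  by case: (x' a); rewrite /= ?mulr1 ?mulr0 ?subrr ?subr0.
have -> : - ln Q = \sum_x mu x * - ln Q by rewrite -mulr_suml mu1 mul1r.
rewrite -subr_ge0 -sumrB.
(* Apply [ln u <= u - 1] to the ratio of the product law to the conditional law. The left-hand side
   is [1] minus the mass of [E] under the product law, hence nonnegative. *)
suff : \sum_x (mu x - mu x * (prod_weight (bern y) x * Q / P x))
    <= \sum_x (mu x * - ln Q - mu x * log_ratio p y x).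
  apply: le_trans; rewrite sumrB mu1 subr_ge0.
  have <- : \sum_x prod_weight (bern y) x = 1 by apply: sum_prod_weight; exact: sum_bern.
  apply: ler_sum => x _; rewrite /mu; case: ifP => _; last first.
    by rewrite mul0r prod_weight_ge0// => *; exact: bern_ge0.
  rewrite le_eqVlt; apply/orP; left; apply/eqP; field.
  by rewrite !gt_eqF.
apply: ler_sum => x _; rewrite -mulrBr -{1}[mu x]mulr1 -mulrBr.
rewrite /mu; case: ifP => [Ex|_]; last by rewrite !mul0r.
rewrite ler_pM2l ?divr_gt0// log_ratioE ?nu0//.
have nx : 0 < prod_weight (bern y) x.
  by rewrite lt_def nu0//= prod_weight_ge0// => *; exact: bern_ge0.
have : ln (prod_weight (bern y) x / P x * Q) <= prod_weight (bern y) x / P x * Q - 1.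
  by apply: ln_le_subr1; rewrite mulr_gt0 ?divr_gt0.
by rewrite lnM ?posrE ?divr_gt0// (mulrAC _ Q) -/P; lra.
Qed.

(* Data processing for the event [E]: its probability under the tilted law
   [bern y] is traded against the entropy cost of the tilt. *)
Lemma entropy_ge_Pr (p : R) y E : 0 < p < 1 -> (forall a, 0 <= y a <= 1) ->
  0 < bern_Pr y E ->
  0 < bern_Pr (fun=> p) E /\
  bern_Pr y E * - ln (bern_Pr (fun=> p) E) <= entropy p y + 1.
Proof.
move=> p01 y01; set Q := bern_Pr y E; set Q' := bern_Pr _ E => Q0.
pose P := prod_weight (bern (fun=> p)); pose nu := prod_weight (bern y).
have P0 x : 0 < P x by exact: prod_weight_bern_gt0.
have nu0 x : 0 <= nu x by rewrite prod_weight_ge0// => *; exact: bern_ge0.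
have nu1 : \sum_x nu x = 1 by apply: sum_prod_weight; exact: sum_bern.
have P1 : \sum_x P x = 1 by apply: sum_prod_weight; exact: sum_bern.
have Q'0 : 0 < Q'.
  have Q'ge : 0 <= Q' by apply: sumr_ge0 => x _; exact: ltW.
  rewrite lt_def Q'ge andbT; apply: contraTN Q0 => /eqP Q'0.
  rewrite -leNgt /Q /bern_Pr big1// => x Ex.
  have : P x <= Q'.
    by rewrite /Q' /bern_Pr (bigD1 x)//= lerDl sumr_ge0// => z _; exact: ltW.
  by rewrite Q'0 leNgt P0.
split=> //.
have muy a : \sum_x nu x * (x a)%:R = y a.
  rewrite (sum_prod_weight_marginal (sum_bern y) a (fun b : bool => b%:R)).
  by rewrite big_bool /= /bern mulr1 mulr0 addr0.
rewrite -(entropy_mean p nu1 muy).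
(* For every [t > 0] the right-hand side is at least [nu x * (1 + ln t) - P x * t]. Here [t = Q'^-1]
   on [E] and [t = 1] off [E]; after summation the terms without [ln Q'] add up to
   [Q' - 1 >= -1]. *)
have key x : (if E x then nu x * (1 - ln Q') - P x / Q' else nu x - P x)
    <= nu x * log_ratio p y x.
  have [nx|nx] := eqVneq (nu x) 0.
    rewrite nx !mul0r; have := P0 x => h; case: ifP => _; last lra.
    by rewrite sub0r oppr_le0 divr_ge0// ltW.
  have {}nx : 0 < nu x by rewrite lt_def nx nu0.
  have gen t : 0 < t -> nu x * (1 + ln t) - P x * t <= nu x * log_ratio p y x.
    move=> t0; rewrite log_ratioE ?gt_eqF//.
    have q0 : 0 < nu x / P x by rewrite divr_gt0.
    have h : ln (t / (nu x / P x)) <= t / (nu x / P x) - 1.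
      by apply: ln_le_subr1; rewrite divr_gt0.
    rewrite ln_div ?posrE// in h.
    rewrite -subr_ge0.
    have -> : nu x * ln (nu x / P x) - (nu x * (1 + ln t) - P x * t)
      = nu x * ((t / (nu x / P x) - 1) - (ln t - ln (nu x / P x))).
      by rewrite invf_div; field; rewrite gt_eqF.
    by rewrite mulr_ge0 ?subr_ge0// ltW.
  case: ifP => _; first by have := gen Q'^-1; rewrite lnV ?posrE// invr_gt0; exact.
  by have := gen 1 ltr01; rewrite ln1 addr0 !mulr1.
have : \sum_x (if E x then nu x * (1 - ln Q') - P x / Q' else nu x - P x)
   <= \sum_x nu x * log_ratio p y x by apply: ler_sum => x _; exact: key.
rewrite (bigID E) /=.
rewrite (eq_bigr (fun x => nu x * (1 - ln Q') - P x / Q')); last by move=> x ->.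
rewrite [X in _ + X](eq_bigr (fun x => nu x - P x)); last by move=> x /negbTE ->.
rewrite !sumrB -!mulr_suml -/(bern_Pr _ _) -/Q -/(bern_Pr (fun=> p) E) -/Q'.
rewrite divff ?gt_eqF//.
have -> : \sum_(x | ~~ E x) nu x = 1 - Q.
  by rewrite -nu1 [in RHS](bigID E) /= [X in _ = X - _]addrC addrK.
have -> : \sum_(x | ~~ E x) P x = 1 - Q'.
  by rewrite -P1 [in RHS](bigID E) /= [X in _ = X - _]addrC addrK.
set s := \sum_x _; set l := ln _; clearbody s l; lra.
Qed.

End RandomSubset.

(** * Quadratic lower bound for relative entropy *)

Section Pinsker.
Context {R : realType}.

(** Write [ln (x / p)] as [-2 ln (sqrt p / sqrt x)] and apply [ln u <= u - 1]; at [x = 0] both sides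
    vanish. *)
Lemma mul_ln_ratio_ge (p x : R) : 0 < p -> 0 <= x ->
  2 * (x - Num.sqrt x * Num.sqrt p) <= x * ln (x / p).
Proof.
move=> p0; rewrite le_eqVlt => /predU1P[<-|x0]; first by rewrite sqrtr0; lra.
have sx : 0 < Num.sqrt x by rewrite sqrtr_gt0.
have sp : 0 < Num.sqrt p by rewrite sqrtr_gt0.
have -> : ln (x / p) = - (ln (Num.sqrt p / Num.sqrt x) *+ 2).
  rewrite -{1}(sqr_sqrtr (ltW x0)) -{1}(sqr_sqrtr (ltW p0)) -expr_div_n.
  by rewrite lnXn ?divr_gt0// -mulNrn -lnV ?posrE ?divr_gt0// invf_div.
have h : ln (Num.sqrt p / Num.sqrt x) <= Num.sqrt p / Num.sqrt x - 1.
  by apply: ln_le_subr1; rewrite divr_gt0.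
have -> : x - Num.sqrt x * Num.sqrt p = - (x * (Num.sqrt p / Num.sqrt x - 1)).
  by rewrite -{1 3}(sqr_sqrtr (ltW x0)); field; rewrite gt_eqF.
rewrite [leRHS](_ : _ = 2 * - (x * ln (Num.sqrt p / Num.sqrt x))); last by ring.
by rewrite ler_pM2l// lerN2 ler_pM2l.
Qed.

(** Relative entropy dominates the squared Hellinger distance, in particular [(sqrt x - sqrt p)^2],
    and [|x - p| <= 2 |sqrt x - sqrt p|]. *)
Lemma relative_entropy_ge (p x : R) : 0 < p < 1 -> 0 <= x <= 1 ->
  (x - p) ^+ 2 / 4 <= relative_entropy p x.
Proof.
move=> /andP[p0 p1] /andP[x0 x1].
have h1 := mul_ln_ratio_ge p0 x0.
have p1' : 0 < 1 - p by lra.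
have x1' : 0 <= 1 - x by lra.
have h2 := mul_ln_ratio_ge p1' x1'.
rewrite /relative_entropy.
have e1 := sqr_sqrtr x0; have e2 := sqr_sqrtr (ltW p0).
have e3 := sqr_sqrtr x1'; have e4 := sqr_sqrtr (ltW p1').
have g1 := sqrtr_ge0 x; have g2 := sqrtr_ge0 p.
have l1 : Num.sqrt x <= 1 by rewrite -sqrtr1 ler_wsqrtr.
have l2 : Num.sqrt p <= 1 by rewrite -sqrtr1 ler_wsqrtr// ltW.
set sx := Num.sqrt x in h1 e1 g1 l1 *; set sp := Num.sqrt p in h1 e2 g2 l2 *.
set tx := Num.sqrt (1 - x) in h2 e3; set tp := Num.sqrt (1 - p) in h2 e4.
suff : (x - p) ^+ 2 / 4 <= (sx - sp) ^+ 2.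
  have h3 := sqr_ge0 (tx - tp) => h4; apply: le_trans h4 _.
  apply: le_trans (lerD h1 h2); rewrite -subr_ge0.
  rewrite [X in 0 <= X](_ : _ = (tx - tp) ^+ 2)// !sqrrB e1 e2 e3 e4; ring.
rewrite -{1}e1 -{1}e2 subr_sqr exprMn -mulrA ler_piMr ?sqr_ge0//.
rewrite ler_pdivrMr// mul1r.
have -> : 4 = 2 ^+ 2 :> R by ring.
by rewrite ler_sqr ?nnegrE; lra.
Qed.

End Pinsker.

(** * Multilinear forms and the entropic upper bound on the tail *)

Section Forms.
Context {R : realType} {I P : finType} {k : nat}.
Variable v : P -> 'I_k -> I.
Implicit Types (F : 'I_k -> I -> R) (z f : I -> R) (i j : 'I_k).

(** [P] indexes the progressions and [v e i] is the [i]-th term of [e]; one function per position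
    allows the factors to be replaced one at a time. *)
Definition ap_form F : R := \sum_e \prod_i F i (v e i).

Definition ap_count f : R := ap_form (fun=> f).

Definition upd F i z : 'I_k -> I -> R := fun j => if j == i then z else F j.

Definition ap_dual F i (a : I) : R :=
  \sum_(e | v e i == a) \prod_(j | j != i) F j (v e j).

Lemma ap_form_upd F i z : ap_form (upd F i z) = \sum_a z a * ap_dual F i a.
Proof.
rewrite /ap_form (partition_big (fun e => v e i) predT)//=.
apply: eq_bigr => a _; rewrite mulr_sumr; apply: eq_bigr => e /eqP ea.
rewrite (bigD1 i)//= /upd eqxx ea; congr *%R.
by apply: eq_bigr => j /negbTE ->.
Qed.

(* [z] is detectable when, put in one of the [k] positions, it correlates with
   bounded functions put in the other ones. *)
Definition detectable (eps : R) z : Prop :=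
  exists i F, (forall j a, 0 <= F j a <= 1) /\
    eps * #|I|%:R ^+ 2 < `|ap_form (upd F i z)|.

(** Telescoping over hybrids that carry [y] in the positions before [m] and [x] from [m] on;
    consecutive hybrids differ in one position only. *)
Lemma ap_count_sub (x y : I -> R) :
  ap_count x - ap_count y = \sum_(m < k)
    ap_form (upd (fun j a => if (j < m)%N then y a else x a) m (fun a => x a - y a)).
Proof.
pose H m : R := ap_form (fun j a => if (j < m)%N then y a else x a).
have -> : ap_count x = H 0%N by [].
have -> : ap_count y = H k.
  apply: eq_bigr => e _; apply: eq_bigr => j _; by rewrite ltn_ord.
rewrite -[LHS]opprB -telescope_sumr// -sumrN big_mkord.
apply: eq_bigr => m _; rewrite opprB /H /ap_form -sumrB; apply: eq_bigr => e _.
rewrite (bigD1 m)//= [X in _ - X](bigD1 m)//= [RHS](bigD1 m)//=.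
rewrite ltnn ltnSn /upd eqxx.
rewrite (eq_bigr (fun j : 'I_k => if (j < m)%N then y (v e j) else x (v e j)))//.
rewrite [X in _ = _ * X](eq_bigr
  (fun j : 'I_k => if (j < m)%N then y (v e j) else x (v e j)));
  last by move=> j /negbTE ->.
rewrite mulrBl; congr (_ - _ * _).
apply: eq_bigr => j jm; rewrite ltnS leq_eqVlt.
by rewrite -[(j == m :> nat)]/(j == m) (negbTE jm).
Qed.

Lemma ap_count_le_detectable (eps : R) (x y : I -> R) :
  (forall a, 0 <= x a <= 1) -> (forall a, 0 <= y a <= 1) ->
  ~ detectable eps (fun a => x a - y a) ->
  ap_count x - ap_count y <= k%:R * (eps * #|I|%:R ^+ 2).
Proof.
move=> x01 y01 nd; rewrite ap_count_sub.
rewrite -[X in X%:R * _]card_ord mulr_natl -sumr_const; apply: ler_sum => m _.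
apply: le_trans (ler_norm _) _; rewrite leNgt; apply/negP => lt; apply: nd.
exists m; eexists; split; last exact: lt.
by move=> j a /=; case: ifP => _.
Qed.

Section Greedy.
Context {D : finType}.
Variables (vec : D -> I -> R) (bad : (I -> R) -> Prop) (gain : R).
Hypothesis step : forall z, bad z -> exists d,
  \sum_a (z a - vec d a) ^+ 2 <= \sum_a z a ^+ 2 - gain.

(* The steps have a fixed length, so an approximation is coded by the sequence of
   dictionary elements alone; [None] pads sequences to a common length. *)
Definition approx n (s : n.-tuple (option D)) (a : I) : R :=
  \sum_(d <- s) oapp (vec^~ a) 0 d.

(** As long as the residual is bad, one more subtraction lowers its squared norm by [gain]. The
    squared norm is nonnegative, so this happens fewer than [n] times. *)
Lemma greedy_approx n z : \sum_a z a ^+ 2 < n%:R * gain ->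
  exists s : n.-tuple (option D), ~ bad (fun a => z a - approx s a).
Proof.
elim: n z => [|n IH] z.
  by rewrite mul0r ltNge sumr_ge0// => a _; exact: sqr_ge0.
move=> zn; have [/step[d dz]|nb] := pselect (bad z).
  have [|s ns] := IH (fun a => z a - vec d a).
    by apply: le_lt_trans dz _; rewrite ltrBlDr -[X in _ + X]mul1r -mulrDl natr1.
  exists [tuple of Some d :: s] => b; apply: ns; move: b; congr bad.
  by apply/funext => a; rewrite /approx big_cons /= opprD addrA.
exists [tuple of nseq n.+1 None] => b; apply: nb; move: b; congr bad.
apply/funext => a; rewrite /approx big1_seq ?subr0// => d /=.
by rewrite inE => /orP[/eqP->|/nseqP[->]].
Qed.

End Greedy.

(** Pigeonhole: the fibers of [g] partition [E], so one of them carries at least the average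
    probability. *)
Lemma bern_Pr_cover {C : finType} (p : R) (E : pred {ffun I -> bool})
    (g : {ffun I -> bool} -> C) : 0 < p < 1 -> 0 < bern_Pr (fun=> p) E ->
  exists c, 0 < bern_Pr (fun=> p) (fun x => E x && (g x == c)) /\
    - ln (bern_Pr (fun=> p) (fun x => E x && (g x == c)))
      <= - ln (bern_Pr (fun=> p) E) + ln #|C|%:R.
Proof.
move=> p01; set Q := bern_Pr _ E => Q0.
pose q c := bern_Pr (fun=> p) (fun x => E x && (g x == c)).
have Qq : Q = \sum_c q c by rewrite /Q /bern_Pr (partition_big g predT).
have C0 : (0 < #|C|)%N.
  rewrite lt0n; apply/eqP => C0; move: Q0.
  by rewrite Qq big_pred0 ?ltxx// => c; have := max_card (pred1 c); rewrite C0 card1.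
have [c Qc] : exists c, Q <= q c * #|C|%:R.
  apply/not_existsP => h; suff : Q < Q by rewrite ltxx.
  rewrite {1}Qq -(ltr_pM2r (_ : 0 < #|C|%:R)) ?ltr0n// mulr_suml.
  have -> : Q * #|C|%:R = \sum_(c : C) Q by rewrite sumr_const mulr_natr.
  apply: ltr_sum => [|c _]; last first.
    by rewrite ltNge; apply/negP/h.
  by have /card_gt0P[c _] := C0; apply/hasP; exists c; rewrite ?mem_index_enum.
have C0' : 0 < #|C|%:R :> R by rewrite ltr0n.
have qc : 0 < q c by rewrite -(pmulr_lgt0 _ C0'); exact: lt_le_trans Qc.
exists c; split => //; rewrite -/(q c) lerNl opprD opprK lerBlDr -lnM ?posrE//.
by rewrite ler_ln ?posrE ?mulr_gt0.
Qed.

(* Split the event according to the code of the approximation. On a piece all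
   points are indistinguishable for the form, hence close to their mean [y]. *)
Lemma entropy_le_upper_tail {D : finType} (vec : D -> I -> R) (gain eps p theta : R)
    n (E : pred {ffun I -> bool}) :
  0 < p < 1 -> #|I|%:R < n%:R * gain ->
  (forall z, detectable eps z -> exists d,
     \sum_a (z a - vec d a) ^+ 2 <= \sum_a z a ^+ 2 - gain) ->
  (forall x, E x -> theta <= ap_count (fun a => (x a)%:R)) ->
  0 < bern_Pr (fun=> p) E ->
  exists y, [/\ forall a, 0 <= y a <= 1,
    entropy p y <= - ln (bern_Pr (fun=> p) E) + n%:R * ln (#|D|.+1)%:R &
    theta - k%:R * (2 * eps * #|I|%:R ^+ 2) <= ap_count y].
Proof.
move=> p01 nI step ET E0.
have code (x : {ffun I -> bool}) : exists s : n.-tuple (option D),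
    ~ detectable eps (fun a => (x a)%:R - approx vec s a).
  apply: (greedy_approx step); apply: le_lt_trans nI.
  rewrite -sum1_card natr_sum; apply: ler_sum => a _.
  by case: (x a); rewrite ?expr1n ?expr0n.
have [g gP] := choice code.
have [s [s0 sle]] := bern_Pr_cover g p01 E0.
set Es := (fun x => E x && _) in s0 sle.
have [] := entropy_le_conditional p01 s0.
set Q := bern_Pr _ Es in s0 sle *; set y := (X in entropy p X) => y01 yle.
exists y; split=> //.
  apply: le_trans yle _; apply: le_trans sle _; rewrite lerD2l.
  by rewrite card_tuple card_option natrX lnXn ?ltr0n// mulr_natl.
have [x0 Ex0] : exists x, Es x.
  apply/not_existsP => h; move: s0; rewrite /Q /bern_Pr big_pred0 ?ltxx// => x.
  by apply/negP/h.
have /andP[/ET T0 /eqP gx0] := Ex0.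
rewrite lerBlDr -lerBlDl; apply: le_trans (lerB T0 (lexx _)) _.
apply: ap_count_le_detectable => // [a|]; first by case: (x0 a); rewrite ?ler01 ?lexx.
move=> [i [F [F01]]]; rewrite ltNge => /negP; apply.
have nd x : Es x ->
    `|\sum_a ((x a)%:R - approx vec s a) * ap_dual F i a| <= eps * #|I|%:R ^+ 2.
  move=> /andP[_ /eqP gx]; rewrite leNgt; apply/negP => lt.
  by apply: (gP x); rewrite gx; exists i, F; split=> //; rewrite ap_form_upd.
rewrite ap_form_upd.
pose W (x : {ffun I -> bool}) : R := \sum_a ((x a)%:R - approx vec s a) * ap_dual F i a.
pose mu (x : {ffun I -> bool}) : R := prod_weight (bern (fun=> p)) x / Q.
have mu0 x : 0 <= mu x by rewrite divr_ge0 ?ltW// prod_weight_bern_gt0.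
have mu1 : \sum_(x | Es x) mu x = 1 by rewrite -mulr_suml divff ?gt_eqF.
(* All points of the piece share one approximation, which cancels: [x0 - y] is the residual of [x0]
   minus the mean residual. Each has correlation at most [eps * #|I|%:R ^+ 2], whence the factor
   2. *)
rewrite [X in `|X|](_ : _ = W x0 - \sum_(x | Es x) mu x * W x).
  rewrite -mulrA mulr_natl mulr2n.
  apply: le_trans (ler_normB _ _) _; apply: lerD; first exact: nd.
  apply: le_trans (ler_norm_sum _ _ _) _.
  rewrite -[leRHS]mul1r -[X in X * _]mu1 mulr_suml; apply: ler_sum => x Ex.
  by rewrite normrM ger0_norm// ler_wpM2l// nd.
under [in RHS]eq_bigr do rewrite mulr_sumr.
rewrite exchange_big /= -sumrB; apply: eq_bigr => a _.
under [in RHS]eq_bigr do rewrite mulrA.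
rewrite -mulr_suml -mulrBl; congr (_ * _).
under [in RHS]eq_bigr do rewrite mulrBr.
rewrite sumrB -mulr_suml mu1 mul1r.
have -> : \sum_(x | Es x) mu x * (x a)%:R = y a.
  by rewrite /y mulr_suml; apply: eq_bigr => x _; rewrite /mu mulrAC.
ring.
Qed.

End Forms.

Lemma exists_le_mean {R : realType} {S : finType} (w X : S -> R) :
  (forall s, 0 <= w s) -> \sum_s w s = 1 ->
  exists s, X s <= \sum_s' w s' * X s'.
Proof.
move=> w0 w1; apply/not_existsP => h; set m := \sum_s' _ in h.
have lt s : m < X s by rewrite ltNge; apply/negP/h.
have [s ws] : exists s, 0 < w s.
  apply/not_existsP => h'; suff : \sum_s w s = 0 by rewrite w1 => /eqP; rewrite oner_eq0.
  by rewrite big1// => s _; apply/eqP; rewrite eq_le w0 andbT leNgt; apply/negP/h'.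
suff : m < m by rewrite ltxx.
rewrite -{1}[m]mul1r -w1 mulr_suml; apply: (@lt_le_trans _ _ (\sum_s' w s' * X s')) => //.
rewrite (bigD1 s)//= [ltRHS](bigD1 s)//=; apply: ltr_leD; first by rewrite ltr_pM2l.
by apply: ler_sum => s' _; rewrite ler_wpM2l// ltW.
Qed.

Lemma sum_option {R : realType} {I : finType} (F : option I -> R) :
  \sum_o F o = F None + \sum_a F (Some a).
Proof.
rewrite (bigD1 None)//=; congr (_ + _).
rewrite (reindex_omap Some id)/=; last by case.
by apply: eq_bigl => a; rewrite eqxx.
Qed.

(** * A dictionary from random samples *)

Section Codegree.
Context {I P : finType} {k : nat}.
Variable v : P -> 'I_k -> I.

(** In a group with torsion two terms in given positions need not determine the progression, so up
    to [k] of them are allowed. *)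
Definition bounded_codegree := forall i j, i != j -> forall a b,
  (#|[pred e | (v e i == a) && (v e j == b)]| <= k)%N.

Hypothesis v_codeg : bounded_codegree.
Hypothesis k2 : (2 <= k)%N.

(** Classify by the term in a second position: each of its possible values leaves at most [k]
    progressions. *)
Lemma card_through i a : (#|[pred e | v e i == a]| <= k * #|I|)%N.
Proof.
have [j ij] : exists j : 'I_k, i != j.
  have k1 : (0 < k)%N by apply: leq_trans k2.
  have [i0|i0] := eqVneq i (Ordinal k2); last by exists (Ordinal k2).
  by exists (Ordinal k1); rewrite i0.
rewrite -sum1_card (partition_big (v^~ j) predT)//= mulnC -sum_nat_const.
by apply: leq_sum => b _; rewrite sum1_card; apply: leq_trans (v_codeg ij a b).
Qed.

Lemma card_edges : (#|P| <= k * #|I| ^ 2)%N.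
Proof.
have k1 : (0 < k)%N by apply: leq_trans k2.
rewrite -sum1_card (partition_big (v^~ (Ordinal k1)) predT)//=.
rewrite -mulnn mulnA mulnC -sum_nat_const.
by apply: leq_sum => b _; rewrite sum1_card; apply: leq_trans (card_through (Ordinal k1) b).
Qed.

End Codegree.

Section Sampling.
Context {R : realType} {I : finType} (m : nat).
Hypotheses (m_gt0 : (0 < m)%N) (I_gt0 : (0 < #|I|)%N).
Local Notation N := (#|I|%:R : R).

(* A weighted sample of [m] points of [I]; [None] absorbs the missing mass, so
   [sample u] below is an unbiased estimate of [f] with [(#|I| + 1) ^ m] values. *)
Definition sample_weight (f : I -> R) (o : option I) : R :=
  if o is Some a then f a / N else 1 - (\sum_a f a) / N.

Definition sample (u : {ffun 'I_m -> option I}) (a : I) : R :=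
  N / m%:R * \sum_l (u l == Some a)%:R.

Variable f : I -> R.
Hypothesis f01 : forall a, 0 <= f a <= 1.
Local Notation W := (prod_weight (fun=> sample_weight f)).

Let N0 : 0 < N. Proof. by rewrite ltr0n. Qed.
Let m0 : 0 < m%:R :> R. Proof. by rewrite ltr0n. Qed.

Lemma sum_sample_weight : \sum_o sample_weight f o = 1.
Proof. by rewrite sum_option /= -mulr_suml subrK. Qed.

Lemma sample_weight_ge0 o : 0 <= sample_weight f o.
Proof.
case: o => [a|] /=; first by apply: divr_ge0; [case/andP: (f01 a) | exact: ltW].
rewrite subr_ge0 ler_pdivrMr// mul1r -sum1_card natr_sum; apply: ler_sum => a _.
by case/andP: (f01 a).
Qed.

Lemma sum_sample_weight_Some a :
  \sum_o sample_weight f o * (o == Some a)%:R = f a / N.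
Proof.
rewrite (bigD1 (Some a))//= eqxx mulr1 big1 ?addr0// => o /negbTE ->.
by rewrite mulr0.
Qed.

Lemma sample_ge0 u a : 0 <= sample u a.
Proof. by rewrite /sample mulr_ge0 ?sumr_ge0// divr_ge0. Qed.

Lemma mean_sample a : \sum_u W u * sample u a = f a.
Proof.
under eq_bigr do rewrite mulrCA mulr_sumr.
rewrite -mulr_sumr exchange_big /=.
under eq_bigr => l _ do rewrite (sum_prod_weight_marginal (fun=> sum_sample_weight) l
  (fun o => (o == Some a)%:R)) sum_sample_weight_Some.
by rewrite sumr_const card_ord -mulr_natl; field; rewrite !gt_eqF.
Qed.

(** Two distinct draws hit [a] and [b] independently, with probability at most [N^-2]. A single draw
    hits both only if [a = b], with probability at most [N^-1]; the [m] coincident pairs give the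
    term [N / m]. *)
Lemma second_moment_sample a b :
  \sum_u W u * (sample u a * sample u b) <= 1 + (a == b)%:R * (N / m%:R).
Proof.
have -> : \sum_u W u * (sample u a * sample u b) = (N / m%:R) ^+ 2 *
   \sum_(l < m) \sum_(l' < m) \sum_u W u * ((u l == Some a)%:R * (u l' == Some b)%:R).
  rewrite (eq_bigr (fun u => (N / m%:R) ^+ 2 * (W u *
    \sum_l \sum_l' (u l == Some a)%:R * (u l' == Some b)%:R))) => [|u _]; last first.
    by rewrite -big_distrlr /= /sample; ring.
  rewrite -mulr_sumr; congr (_ * _).
  under eq_bigr do rewrite mulr_sumr; rewrite exchange_big /=; apply: eq_bigr => l _.
  under eq_bigr do rewrite mulr_sumr; by rewrite exchange_big.
have -> : 1 + (a == b)%:R * (N / m%:R) = (N / m%:R) ^+ 2 *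
   \sum_(l < m) \sum_(l' < m) (N ^- 2 + (l == l')%:R * (a == b)%:R / N).
  under eq_bigr => l _.
    rewrite big_split /= sumr_const card_ord (bigD1 l)//= eqxx mul1r big1 ?addr0; last first.
      by move=> l' /negbTE; rewrite eq_sym => ->; rewrite !mul0r.
    over.
  rewrite sumr_const card_ord -[(_ + _) *+ m]mulr_natl -[_ ^- 2 *+ m]mulr_natl.
  by field; rewrite !gt_eqF.
rewrite ler_wpM2l ?sqr_ge0//; apply: ler_sum => l _; apply: ler_sum => l' _.
have fN c : 0 <= f c / N <= N^-1.
  case/andP: (f01 c) => c0 c1; rewrite divr_ge0//=.
  by rewrite ler_pdivrMr// mulVf// gt_eqF.
have [<-|ll'] := eqVneq l l'; last first.
  rewrite (sum_prod_weight_marginal2 (fun=> sum_sample_weight)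
    (fun o => (o == Some a)%:R) (fun o => (o == Some b)%:R) ll').
  rewrite !sum_sample_weight_Some !mul0r addr0 -exprVn expr2.
  by case/andP: (fN a) => *; case/andP: (fN b) => *; apply: ler_pM.
rewrite (sum_prod_weight_marginal (fun=> sum_sample_weight) l
  (fun o => (o == Some a)%:R * (o == Some b)%:R)).
have [<-|ab] := eqVneq a b.
  under eq_bigr do rewrite -natrM mulnb andbb.
  rewrite sum_sample_weight_Some !mul1r; case/andP: (fN a) => _ h.
  by apply: le_trans h _; rewrite lerDr invr_ge0 sqr_ge0.
rewrite big1 ?mulr0 ?mul0r ?addr0 ?invr_ge0 ?sqr_ge0// => o _.
have [->|] := eqVneq o (Some a); last by rewrite mul0r mulr0.
by rewrite (_ : Some a == Some b = false) ?mulr0//; apply/eqP => -[/eqP]; rewrite (negbTE ab).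
Qed.

End Sampling.

Section SampledDictionary.
Context {R : realType} {I P : finType} {k : nat}.
Variables (v : P -> 'I_k -> I) (m : nat) (B : R).
Hypotheses (v_codeg : bounded_codegree v) (k2 : (2 <= k)%N).
Hypotheses (m_gt0 : (0 < m)%N) (I_gt0 : (0 < #|I|)%N).
Local Notation N := (#|I|%:R : R).
Hypothesis mB : (1 + N / m%:R) ^+ k.-1 <= B.
Implicit Types (F : 'I_k -> I -> R) (i : 'I_k).
Local Notation samples := {ffun 'I_k -> {ffun 'I_m -> option I}}.

Let W F : samples -> R :=
  prod_weight (fun j => prod_weight (fun=> sample_weight (F j))).

Let dual_sample (s : samples) i : I -> R := ap_dual v (fun j => sample (s j)) i.

Let N0 : 0 < N. Proof. by rewrite ltr0n. Qed.
Let m0 : 0 < m%:R :> R. Proof. by rewrite ltr0n. Qed.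

Let B1 : 1 <= B.
Proof. by apply: le_trans mB; rewrite exprn_ege1// lerDl divr_ge0 ?ltW. Qed.

Let sum_block F j : \sum_u prod_weight (fun _ : 'I_m => sample_weight (F j)) u = 1.
Proof. by apply: sum_prod_weight => _; exact: sum_sample_weight. Qed.

Lemma mean_dual_sample F i a : (forall j a, 0 <= F j a <= 1) ->
  \sum_s W F s * dual_sample s i a = ap_dual v F i a.
Proof.
move=> F01; under eq_bigr do rewrite mulr_sumr.
rewrite exchange_big /=; apply: eq_bigr => e _.
rewrite (sum_prod_weight_prod_in (sum_block F) (fun j => j != i)
  (fun j u => sample u (v e j))).
by apply: eq_bigr => j _; rewrite mean_sample.
Qed.

(** Expanding the square gives pairs of progressions with the same [i]-th term, and the mean factors
    over the positions [j]: a factor is at most [1], or [1 + N / m] if the [j]-th terms agree. For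
    each progression at most [k N] pairs cost [1], and at most [k^2] incidences with a second common
    term cost [B]. *)
Lemma second_moment_dual_sample F i : (forall j a, 0 <= F j a <= 1) ->
  \sum_s W F s * (\sum_a dual_sample s i a ^+ 2)
    <= k%:R * N ^+ 2 * (k%:R * N + k%:R ^+ 2 * B).
Proof.
move=> F01.
have -> : \sum_s W F s * (\sum_a dual_sample s i a ^+ 2) =
    \sum_(e : P) \sum_(e' | v e' i == v e i)
      \prod_(j | j != i) \sum_(u : {ffun 'I_m -> option I})
        prod_weight (fun=> sample_weight (F j)) u
        * (sample u (v e j) * sample u (v e' j)).
  transitivity (\sum_s \sum_e \sum_(e' | v e' i == v e i) W F s *
      \prod_(j | j != i) (sample (s j) (v e j) * sample (s j) (v e' j))).
    apply: eq_bigr => s _.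
    rewrite [RHS](partition_big (v^~ i) predT)//= mulr_sumr; apply: eq_bigr => a _.
    rewrite expr2 /dual_sample {1}/ap_dual mulr_suml mulr_sumr; apply: eq_bigr => e /eqP ea.
    rewrite /ap_dual !mulr_sumr ea; apply: eq_bigr => e' _.
    by rewrite -big_split.
  rewrite exchange_big /=; apply: eq_bigr => e _.
  rewrite exchange_big /=; apply: eq_bigr => e' _.
  by rewrite (sum_prod_weight_prod_in (sum_block F) (fun j => j != i)
    (fun j u => sample u (v e j) * sample u (v e' j))).
have pt e e' : \prod_(j | j != i) \sum_(u : {ffun 'I_m -> option I})
        prod_weight (fun=> sample_weight (F j)) u
        * (sample u (v e j) * sample u (v e' j))
    <= 1 + \sum_(j | j != i) (v e j == v e' j)%:R * B.
  apply: (@le_trans _ _ (\prod_(j | j != i) (1 + (v e j == v e' j)%:R * (N / m%:R)))).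
    apply: ler_prod => j _; rewrite second_moment_sample// andbT.
    apply: sumr_ge0 => u _; rewrite mulr_ge0//.
      by apply: prod_weight_ge0 => _ o; exact: sample_weight_ge0.
    by rewrite mulr_ge0// sample_ge0.
  have [/existsP[j /andP[ji vj]]|/existsPn none] :=
      boolP [exists j, (j != i) && (v e j == v e' j)].
    apply: (@le_trans _ _ B); last first.
      rewrite (bigD1 j)//= vj mul1r; have : 0 <= B by apply: le_trans B1.
      have : 0 <= \sum_(l | (l != i) && (l != j)) (v e l == v e' l)%:R * B.
        by apply: sumr_ge0 => l _; rewrite mulr_ge0// (le_trans _ B1).
      lra.
    apply: le_trans mB.
    have -> : (1 + N / m%:R) ^+ k.-1 = \prod_(j | j != i) (1 + N / m%:R).
      by rewrite prodr_const cardC1 card_ord.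
    apply: ler_prod => l _; case: (_ == _); rewrite ?mul1r ?mul0r.
      by rewrite lexx andbT addr_ge0// divr_ge0 ?ltW.
    by rewrite addr0 ler01 lerDl divr_ge0 ?ltW.
  rewrite big1 => [|j ji]; last first.
    by have := none j; rewrite ji /= => /negbTE ->; rewrite mul0r addr0.
  by rewrite lerDl sumr_ge0// => j _; rewrite mulr_ge0// (le_trans _ B1).
have B0 : 0 <= B by apply: le_trans B1.
have row e : \sum_(e' | v e' i == v e i) (1 + \sum_(j | j != i) (v e j == v e' j)%:R * B)
    <= k%:R * N + k%:R ^+ 2 * B.
  rewrite big_split /= lerD//.
    rewrite sumr_const -natrM ler_nat.
    by apply: leq_trans (card_through v_codeg k2 i (v e i)).
  have -> : k%:R ^+ 2 * B = \sum_(j < k) k%:R * B.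
    by rewrite sumr_const card_ord -[RHS]mulr_natl expr2 mulrA.
  rewrite exchange_big /=.
  rewrite big_mkcond /=; apply: ler_sum => j _.
  case: ifP => [ji|_]; last by rewrite mulr_ge0.
  rewrite -mulr_suml ler_wpM2r// -natr_sum ler_nat.
  rewrite -big_mkcondr /= sum1_card.
  have /v_codeg := negbT (introF eqP (elimN eqP ji)).
  move=> /(_ (v e j) (v e i)); apply: leq_trans; apply: eq_leq; apply: eq_card => e'.
  by rewrite !unfold_in /= andbC [v e j == _]eq_sym.
apply: (@le_trans _ _ (\sum_(e : P) (k%:R * N + k%:R ^+ 2 * B))).
  by apply: ler_sum => e _; apply: le_trans (row e); apply: ler_sum => e' _; exact: pt.
rewrite sumr_const -[leLHS]mulr_natl ler_wpM2r ?addr_ge0 ?mulr_ge0 ?exprn_ge0//.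
by rewrite -natrX -natrM ler_nat (card_edges v_codeg k2).
Qed.

(** The length [t / N] is fixed beforehand, so a member is coded by a position, a sign and
    samples. *)
Definition sampled_vec (t : R) (d : 'I_k * bool * samples) (a : I) : R :=
  (-1) ^+ d.1.2 * (t / N) * dual_sample d.2 d.1.1 a.

(** Average the new squared norm over the samples. By unbiasedness the cross term gains at least
    [2 t eps N], the quadratic term costs at most [t^2 V N], and [t = eps / V] is the best step.
    Some sample does at least as well as the average. *)
Lemma sampled_dictionary (eps V : R) z : 0 < eps -> 0 < V ->
  k%:R * (k%:R * N + k%:R ^+ 2 * B) <= V * N ->
  detectable v eps z ->
  exists d, \sum_a (z a - sampled_vec (eps / V) d a) ^+ 2
    <= \sum_a z a ^+ 2 - eps ^+ 2 / V * N.
Proof.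
move=> eps0 V0 BV [i [F [F01 zF]]].
pose b := ap_form v (upd F i z) < 0; pose t := eps / V.
have W0 s : 0 <= W F s.
  apply: prod_weight_ge0 => j u; apply: prod_weight_ge0 => _ o.
  exact: sample_weight_ge0.
have W1 : \sum_s W F s = 1 by apply: sum_prod_weight => j; exact: sum_block.
have [s sP] := exists_le_mean
  (fun s => \sum_a (z a - sampled_vec t (i, b, s) a) ^+ 2) W0 W1.
exists (i, b, s); apply: le_trans sP _.
have -> : \sum_s W F s * \sum_a (z a - sampled_vec t (i, b, s) a) ^+ 2 =
    \sum_a z a ^+ 2 - 2 * (t / N) * `|ap_form v (upd F i z)| +
      (t / N) ^+ 2 * \sum_s W F s * \sum_a dual_sample s i a ^+ 2.
  transitivity (\sum_s (W F s * (\sum_a z a ^+ 2)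
     - 2 * ((-1) ^+ b * (t / N)) * (W F s * \sum_a z a * dual_sample s i a)
     + (t / N) ^+ 2 * (W F s * \sum_a dual_sample s i a ^+ 2))).
    apply: eq_bigr => s' _.
    rewrite (mulrCA _ (W F s')) (mulrCA _ (W F s')) -mulrBr -mulrDr; congr (_ * _).
    rewrite !mulr_sumr -sumrB -big_split /=; apply: eq_bigr => a _.
    rewrite /sampled_vec /=; set u := (-1) ^+ b * _.
    have -> : (t / N) ^+ 2 = u ^+ 2 by rewrite /u [RHS]exprMn sqrr_sign mul1r.
    ring.
  rewrite big_split sumrB /= -!mulr_sumr -mulr_suml W1 mul1r; congr (_ - _ + _).
  rewrite normrEsign -/b ap_form_upd.
  under eq_bigr do rewrite mulr_sumr; rewrite exchange_big /=.
  rewrite (_ : \sum_j _ = \sum_a z a * ap_dual v F i a); first by ring.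
  apply: eq_bigr => a _; rewrite -(mean_dual_sample i a F01) mulr_sumr.
  by apply: eq_bigr => s' _; rewrite mulrCA.
have E2 := second_moment_dual_sample i F01.
have t0 : 0 < t by rewrite divr_gt0.
have h1 : 2 * (t / N) * (eps * N ^+ 2) <= 2 * (t / N) * `|ap_form v (upd F i z)|.
  by rewrite ler_wpM2l ?ltW// mulr_gt0// divr_gt0.
have h2 : (t / N) ^+ 2 * \sum_s W F s * \sum_a dual_sample s i a ^+ 2
    <= (t / N) ^+ 2 * (N ^+ 2 * (V * N)).
  rewrite ler_wpM2l ?sqr_ge0//; apply: le_trans E2 _.
  by rewrite (mulrC k%:R) -mulrA ler_wpM2l// sqr_ge0.
have e1 : 2 * (t / N) * (eps * N ^+ 2) = 2 * (eps ^+ 2 / V * N).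
  by rewrite /t; field; rewrite !gt_eqF.
have e2 : (t / N) ^+ 2 * (N ^+ 2 * (V * N)) = eps ^+ 2 / V * N.
  by rewrite /t; field; rewrite !gt_eqF.
rewrite e1 in h1; rewrite e2 in h2.
by apply: le_trans (lerD (lerB (lexx _) h1) h2) _; rewrite mulr_natl mulr2n; lra.
Qed.

End SampledDictionary.

(** * The Fourier dictionary for three-term progressions *)

Section ComplexNorm.
Context {R : realType}.
Local Open Scope complex_scope.
Implicit Types (x : R) (z : R[i]).

Lemma norm_real_complex x : `|x%:C| = `|x|%:C.
Proof. by rewrite normc_def /= expr0n addr0 sqrtr_sqr. Qed.

Lemma Re_sum (J : Type) (s : seq J) (F : J -> R[i]) :
  complex.Re (\sum_(j <- s) F j) = \sum_(j <- s) complex.Re (F j).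
Proof. by apply: big_morph => // -[a b] [c d]. Qed.

Lemma Im_sum (J : Type) (s : seq J) (F : J -> R[i]) :
  complex.Im (\sum_(j <- s) F j) = \sum_(j <- s) complex.Im (F j).
Proof. by apply: big_morph => // -[a b] [c d]. Qed.

Lemma Re_scale x z : complex.Re (x%:C * z) = x * complex.Re z.
Proof. by case: z => a b /=; rewrite mul0r subr0. Qed.

Lemma Im_scale x z : complex.Im (x%:C * z) = x * complex.Im z.
Proof. by case: z => a b /=; rewrite mul0r addr0. Qed.

Lemma norm_le_Re_Im x z : `|complex.Re z| <= x / 2 -> `|complex.Im z| <= x / 2 ->
  `|z| <= x%:C.
Proof.
move=> h1 h2; rewrite normc_def lecR.
have x0 : 0 <= x by have := le_trans (normr_ge0 _) h1; lra.
rewrite -(ger0_norm x0) -sqrtr_sqr ler_wsqrtr//.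
rewrite -[complex.Re z ^+ 2]real_normK ?num_real// -[complex.Im z ^+ 2]real_normK ?num_real//.
have g1 : `|complex.Re z| ^+ 2 <= (x / 2) ^+ 2 by rewrite ler_sqr ?nnegrE//; lra.
have g2 : `|complex.Im z| ^+ 2 <= (x / 2) ^+ 2 by rewrite ler_sqr ?nnegrE//; lra.
apply: le_trans (lerD g1 g2) _; have := sqr_ge0 x.
by rewrite expr_div_n; set y := x ^+ 2; lra.
Qed.

Lemma Re_Im_le1 z : `|z| = 1 -> `|complex.Re z| <= 1 /\ `|complex.Im z| <= 1.
Proof.
move=> z1; have : (complex.Re z ^+ 2 + complex.Im z ^+ 2) = 1 :> R.
  by have := add_Re2_Im2 z; rewrite z1 expr1n => -[].
have := sqr_ge0 (complex.Re z); have := sqr_ge0 (complex.Im z).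
move=> h1 h2 h3; split; rewrite -sqrtr_sqr -sqrtr1 ler_wsqrtr//; lra.
Qed.

(** ['X^n - 1] splits over the closed field [R[i]] and is separable in characteristic zero; among
    its [n] distinct roots one is primitive. *)
Lemma exists_prim_root n : (0 < n)%N -> exists z : R[i], n.-primitive_root z.
Proof.
pose p : {poly R[i]} := 'X^n - 1; have [r Dp] := closed_field_poly_normal p.
move=> n_gt0; rewrite (monicP _) ?monicXnsubC // scale1r in Dp.
have rn1 : all n.-unity_root r by apply/allP => z; rewrite -root_prod_XsubC -Dp.
have sz_r : (n < (size r).+1)%N.
  by rewrite -(size_prod_XsubC r id) -Dp size_XnsubC.
have [|z] := hasP (has_prim_root n_gt0 rn1 _ sz_r); last by exists z.
by rewrite -separable_prod_XsubC -Dp separable_Xn_sub_1 // pnatr_eq0 -lt0n.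
Qed.

End ComplexNorm.

(** * Fourier sums over roots of unity *)

Section FourierSum.
Context {R : realType} {I : finType} (M : nat).
Local Notation C := R[i].
Local Notation N := (#|I|%:R : R).
Hypothesis M_gt0 : (0 < M)%N.
Local Notation "r %:C" := (real_complex R r).

Definition fourier_sum (u : I -> C) (g : I -> R) (xi : nat) : C :=
  \sum_a (g a)%:C * u a ^+ xi.

Lemma sum_root_powers (w : C) : w ^+ M = 1 ->
  \sum_(xi < M) w ^+ xi = if w == 1 then M%:R else 0.
Proof.
move=> wM; case: eqP => [->|/eqP w1].
  by under eq_bigr do rewrite expr1n; rewrite sumr_const card_ord.
have := subrX1 w M; rewrite wM subrr => /eqP.
by rewrite eq_sym mulf_eq0 subr_eq0 (negbTE w1) /= => /eqP.
Qed.

Lemma norm_root (w : C) : w ^+ M = 1 -> `|w| = 1.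
Proof.
move=> wM; apply: (pexpIrn M_gt0); rewrite ?nnegrE ?ler01//.
by rewrite -normrX wM normr1 expr1n.
Qed.

(** Orthogonality keeps only the pairs with [u a = u b]. Fibers of size two must be allowed because
    the middle term of a progression enters through a square. *)
Lemma parseval_le (u : I -> C) (g : I -> R) :
  (forall a, u a ^+ M = 1) -> (forall a, (#|[pred b | u b == u a]| <= 2)%N) ->
  (forall a, 0 <= g a <= 1) ->
  \sum_(xi < M) `|fourier_sum u g xi| ^+ 2 <= (2 * M%:R * N)%:C.
Proof.
move=> uM fib g01.
have u0 a : u a != 0.
  by apply/eqP => h; have := uM a; rewrite h expr0n gtn_eqF// => /eqP; rewrite eq_sym oner_eq0.
have uconj a : Num.conj (u a) = (u a)^-1.
  by rewrite invC_norm norm_root// expr1n invr1 mul1r.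
have gconj a : Num.conj ((g a)%:C : C) = (g a)%:C.
  by apply: conj_Creal; apply: ger0_real; rewrite (lecR 0); case/andP: (g01 a).
have -> : \sum_(xi < M) `|fourier_sum u g xi| ^+ 2 =
    \sum_a \sum_b (g a * g b)%:C * \sum_(xi < M) (u a / u b) ^+ xi.
  under [RHS]eq_bigr do under eq_bigr do rewrite mulr_sumr.
  under [RHS]eq_bigr do rewrite exchange_big /=.
  rewrite [RHS]exchange_big /=; apply: eq_bigr => xi _.
  rewrite normCK /fourier_sum rmorph_sum big_distrlr /=.
  apply: eq_bigr => a _; apply: eq_bigr => b _.
  rewrite !rmorphM rmorphXn /= uconj gconj exprMn; ring.
have -> : (2 * M%:R * N)%:C = \sum_(a : I) (2 * M%:R)%:C :> C.
  by rewrite sumr_const -[RHS]mulr_natr rmorphM rmorph_nat.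
apply: ler_sum => a _.
apply: (@le_trans _ _ (\sum_(b | u b == u a) M%:R)).
  rewrite [leRHS]big_mkcond /=; apply: ler_sum => b _.
  rewrite sum_root_powers ?expr_div_n ?uM ?divr1//.
  rewrite -(inj_eq (mulIf (u0 b))) mul1r divfK// eq_sym.
  case: eqP => _; last by rewrite mulr0.
  rewrite ler_piMl ?ler0n// (lecR _ 1).
  by case/andP: (g01 a) => *; case/andP: (g01 b) => *; rewrite mulr_ile1.
rewrite sumr_const -[leLHS]mulr_natl rmorphM !rmorph_nat ler_wpM2r ?ler0n//.
by rewrite ler_nat; apply: leq_trans (fib a); apply: eq_leq; apply: eq_card.
Qed.

End FourierSum.

(** * The three-term form in Fourier coefficients *)

Section FourierDictionary.
Context {R : realType} {I P : finType} (M : nat).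
Local Notation C := R[i].
Local Notation N := (#|I|%:R : R).
Local Notation "r %:C" := (real_complex R r).
Variables (v : P -> 'I_3 -> I) (e : I -> C).
Hypotheses (M_gt0 : (0 < M)%N) (I_gt0 : (0 < #|I|)%N).
Hypotheses (e_root : forall a, e a ^+ M = 1) (e_inj : injective e).
Hypothesis edge_eq : forall q,
  e (v q 0) * e (v q 1) ^- 2 * e (v q (inord 2)) = 1.
Hypothesis edge_inj : forall q q' : P, v q =1 v q' -> q = q'.
Hypothesis edge_surj : forall a b c, e a * e b ^- 2 * e c = 1 ->
  exists q, [/\ v q 0 = a, v q 1 = b & v q (inord 2) = c].

(** Three-term progressions solve [a - 2 b + c = 0]; in multiplicative form the middle term
    contributes [e b ^- 2]. *)
Let phase (j : 'I_3) (a : I) : C := if j == 1 then e a ^- 2 else e a.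

Let phase_root j a : phase j a ^+ M = 1.
Proof.
rewrite /phase; case: ifP => _ //.
by rewrite -exprVn exprAC exprVn e_root invr1 expr1n.
Qed.

Let phase_fiber j a : (#|[pred b | phase j b == phase j a]| <= 2)%N.
Proof.
rewrite /phase; case: ifP => _; last first.
  by rewrite (fintype.eq_card1 (x := a))// => b; rewrite !inE (inj_eq e_inj).
apply: (@leq_trans (#|[pred b | b == a]| + #|[pred b | e b == - e a]|)); last first.
  rewrite (fintype.eq_card1 (x := a))// add1n ltnS; apply/card_le1_eqP => b c.
  by rewrite !inE => /eqP hb /eqP hc; apply: e_inj; rewrite hb hc.
rewrite -cardUI; apply: leq_trans (leq_addr _ _); apply: subset_leq_card.
apply/fintype.subsetP => b; rewrite !inE (inj_eq invr_inj) eqf_sqr.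
by rewrite (inj_eq e_inj).
Qed.

(** Summing [w t ^+ xi] over [xi] detects the triples with [w t = 1], which the edge hypotheses
    identify with the progressions. *)
Lemma ap_form_fourier (F : 'I_3 -> I -> R) :
  M%:R * (ap_form v F)%:C
    = \sum_(xi < M) \prod_(j < 3) fourier_sum (phase j) (F j) xi :> C.
Proof.
pose tr q := (v q 0, v q 1, v q (inord 2)).
have ord3 (G : 'I_3 -> C) : \prod_(j < 3) G j = G 0 * G 1 * G (inord 2).
  rewrite !big_ord_recl big_ord0 mulr1 mulrA; congr (_ * _ * _); congr G.
    by apply/val_inj.
  by apply/val_inj; rewrite /= inordK.
have trI : injective tr.
  move=> q q' [h0 h1 h2]; apply: edge_inj => j.
  have [->//|j0] := eqVneq j 0; have [->//|j1] := eqVneq j 1.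
  suff -> : j = inord 2 by [].
  by apply/val_inj; rewrite /= inordK//; case: j j0 j1 => -[|[|[]]].
pose G (t : I * I * I) : C := (F 0 t.1.1)%:C * (F 1 t.1.2)%:C * (F (inord 2) t.2)%:C.
pose w (t : I * I * I) : C := e t.1.1 * e t.1.2 ^- 2 * e t.2.
have -> : (ap_form v F)%:C = \sum_(t | w t == 1) G t.
  rewrite /ap_form rmorph_sum.
  rewrite (eq_bigr (fun q => G (tr q))) => [|q _]; last first.
    by rewrite rmorph_prod ord3.
  have -> : \sum_(t | w t == 1) G t = \sum_(t in imset tr (mem (predT : pred P))) G t.
    apply: eq_bigl => -[[a b] c]; apply/eqP/imsetP => [/edge_surj[q [/= <- <- <-]]|[q _ ->]].
      by exists q.
    exact: edge_eq.
  rewrite big_imset /=; last by move=> q q' _ _; exact: trI.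
  by [].
rewrite mulr_sumr big_mkcond /=.
have wM t : w t ^+ M = 1.
  by rewrite /w !exprMn !e_root -exprVn exprAC exprVn e_root invr1 expr1n !mul1r.
transitivity (\sum_t \sum_(xi < M) G t * w t ^+ xi).
  apply: eq_bigr => t _; rewrite -mulr_sumr sum_root_powers//.
  by case: eqP => _; rewrite ?mulr0// mulrC.
rewrite exchange_big /=; apply: eq_bigr => xi _.
rewrite ord3 /fourier_sum big_distrlr /= pair_big /= mulr_suml.
under [RHS]eq_bigr do rewrite mulr_sumr.
rewrite pair_big /=; apply: eq_bigr => -[[a b] c] _ /=.
rewrite /G /w /phase /= (_ : inord 2 == 1 = false); last first.
  by apply/eqP => /(congr1 val); rewrite /= inordK.
rewrite !exprMn; ring.
Qed.

(** The coefficient of [z] is taken out in supremum norm, the product of the other two is at most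
    half the sum of their squares, and Parseval bounds each sum of squares by [2 M N]. *)
Lemma ap_form_fourier_le (F : 'I_3 -> I -> R) i z b :
  (forall j a, 0 <= F j a <= 1) -> 0 <= b ->
  (forall xi : 'I_M, `|fourier_sum (phase i) z xi| <= b%:C) ->
  `|ap_form v (upd F i z)| <= 2 * b * N.
Proof.
move=> F01 b0 zb.
have M0 : 0 < (M%:R : R) by rewrite ltr0n.
rewrite -lecR -(ler_pM2l (_ : 0 < M%:R)) ?ltr0n// -norm_real_complex.
rewrite -[X in X * `|_|]normr_nat -normrM ap_form_fourier.
apply: le_trans (ler_norm_sum _ _ _) _.
have [j1 [j2 [j12 ji]]] : exists j1 j2 : 'I_3, j1 != j2 /\
    forall j, (j != i) = (j == j1) || (j == j2).
  case: i {zb} => -[|[|[|//]]] hi.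
  - by exists 1, (inord 2); split; [|case=> -[|[|[|//]]] h];
      rewrite -!val_eqE /= ?inordK.
  - by exists 0, (inord 2); split; [|case=> -[|[|[|//]]] h];
      rewrite -!val_eqE /= ?inordK.
  - by exists 0, 1; split; [|case=> -[|[|[|//]]] h]; rewrite -!val_eqE.
pose S j (xi : nat) : C := `|fourier_sum (phase j) (F j) xi|.
have S0 j xi : 0 <= S j xi by exact: normr_ge0.
apply: (@le_trans _ _ (\sum_(xi < M) (b / 2)%:C * (S j1 xi ^+ 2 + S j2 xi ^+ 2))).
  apply: ler_sum => xi _; rewrite normr_prod (bigD1 i)//= {1}/upd eqxx.
  rewrite (eq_bigl _ _ ji) (bigD1 j1) ?eqxx//= (big_pred1 j2) => [|j]; last first.
    by case: (eqVneq j j1) => [->|]; rewrite ?andbF ?andbT//= (negbTE j12).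
  have uE j : j != i -> upd F i z j = F j by rewrite /upd => /negbTE ->.
  rewrite !uE ?ji ?eqxx ?orbT// -/(S j1 xi) -/(S j2 xi).
  apply: (@le_trans _ _ (b%:C * (S j1 xi * S j2 xi))).
    by rewrite ler_wpM2r ?mulr_ge0.
  have -> : b%:C * (S j1 xi * S j2 xi) = (b / 2)%:C * (S j1 xi * S j2 xi *+ 2).
    rewrite -[S j1 xi * S j2 xi *+ 2]mulr_natl [RHS]mulrA; congr (_ * _).
    by rewrite -(rmorph_nat (real_complex R)) -rmorphM divfK ?pnatr_eq0.
  rewrite ler_wpM2l//; first by rewrite (lecR 0) divr_ge0.
  rewrite -subr_ge0 (_ : _ - _ = (S j1 xi - S j2 xi) ^+ 2); last by ring.
  by rewrite real_exprn_even_ge0// rpredB// ger0_real.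
rewrite -mulr_sumr big_split /=.
have par j : \sum_(xi < M) S j xi ^+ 2 <= (2 * M%:R * N)%:C.
  exact: (parseval_le M_gt0 (phase_root j) (phase_fiber j) (F01 j)).
apply: (@le_trans _ _ ((b / 2)%:C * ((2 * M%:R * N)%:C + (2 * M%:R * N)%:C))).
  by rewrite ler_wpM2l ?lerD//; rewrite (lecR 0) divr_ge0.
have -> : (M%:R : C) = (M%:R)%:C by rewrite rmorph_nat.
rewrite -rmorphD -rmorphM -[X in _ <= X]rmorphM lecR.
by rewrite le_eqVlt; apply/orP; left; apply/eqP; field.
Qed.

(** Real and imaginary parts keep the dictionary real-valued; [b] selects the part and [s] the
    sign. *)
Definition fourier_vec (t : R) (d : 'I_3 * 'I_M * bool * bool) (a : I) : R :=
  let: (j, xi, b, s) := d in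
  (-1) ^+ s * t * (if b then @complex.Re R else @complex.Im R) (phase j a ^+ xi).

(** Some Fourier coefficient of [z] exceeds [eps N / 2] in modulus, so its real or imaginary part
    exceeds [eps N / 4]. A step of length [eps / 4] then gains
    [2 (eps / 4) (eps N / 4) - (eps / 4)^2 N]. *)
Lemma fourier_dictionary (eps : R) z : 0 < eps -> detectable v eps z ->
  exists d, \sum_a (z a - fourier_vec (eps / 4) d a) ^+ 2
    <= \sum_a z a ^+ 2 - eps ^+ 2 / 16 * N.
Proof.
move=> eps0 [i [F [F01 zF]]].
have N0 : 0 < N by rewrite ltr0n.
have [xi xiP] : exists xi : 'I_M,
    ~ `|fourier_sum (phase i) z xi| <= (eps * N / 2)%:C.
  apply/not_existsP => h; move: zF; rewrite ltNge => /negP; apply.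
  have b0 : 0 <= eps * N / 2 by rewrite divr_ge0// mulr_ge0// ltW.
  apply: le_trans (ap_form_fourier_le F01 b0 _) _ => [xi|].
    by have := h xi; rewrite not_notE.
  by rewrite le_eqVlt; apply/orP; left; apply/eqP; field.
pose part (b : bool) := if b then @complex.Re R else @complex.Im R.
have [b bP] : exists b, eps * N / 4 < `|part b (fourier_sum (phase i) z xi)|.
  apply/not_existsP => h; apply: xiP; apply: norm_le_Re_Im.
    have := h true; rewrite /= => /negP; rewrite -leNgt; lra.
  have := h false; rewrite /= => /negP; rewrite -leNgt; lra.
pose g a := part b (phase i a ^+ xi).
have gE : part b (fourier_sum (phase i) z xi) = \sum_a z a * g a.
  rewrite /g /fourier_sum; case: (b) => /=.
    by rewrite Re_sum; apply: eq_bigr => a _; rewrite Re_scale.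
  by rewrite Im_sum; apply: eq_bigr => a _; rewrite Im_scale.
rewrite gE in bP.
have g1 a : g a ^+ 2 <= 1.
  have n1 : `|phase i a ^+ xi| = 1.
    by apply: (norm_root M_gt0); rewrite exprAC phase_root expr1n.
  have [] := Re_Im_le1 n1; rewrite /g; case: (b) => /= h1 h2.
    by rewrite -real_normK ?num_real// expr_le1.
  by rewrite -real_normK ?num_real// expr_le1.
pose s := \sum_a z a * g a < 0.
exists (i, xi, b, s).
have -> : \sum_a (z a - fourier_vec (eps / 4) (i, xi, b, s) a) ^+ 2 =
    \sum_a z a ^+ 2 - 2 * (eps / 4) * `|\sum_a z a * g a|
      + (eps / 4) ^+ 2 * \sum_a g a ^+ 2.
  rewrite normrEsign -/s !mulr_sumr -sumrB -big_split /=; apply: eq_bigr => a _.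
  rewrite -[if b then _ else _]/(part b) -/(g a); set r := (-1) ^+ s.
  have r2 : r ^+ 2 = 1 by rewrite /r sqrr_sign.
  rewrite [X in _ = _ + X](_ : _ = r ^+ 2 * ((eps / 4) ^+ 2 * g a ^+ 2)); first by ring.
  by rewrite r2 mul1r.
have h1 : \sum_a g a ^+ 2 <= N.
  by rewrite -sum1_card natr_sum; apply: ler_sum.
have h2 : 2 * (eps / 4) * (eps * N / 4) <= 2 * (eps / 4) * `|\sum_a z a * g a|.
  by rewrite ler_pM2l ?ltW// mulr_gt0// divr_gt0.
have h3 : (eps / 4) ^+ 2 * \sum_a g a ^+ 2 <= (eps / 4) ^+ 2 * N.
  by rewrite ler_wpM2l// sqr_ge0.
apply: le_trans (lerD (lerB (lexx _) h2) h3) _.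
by rewrite le_eqVlt; apply/orP; left; apply/eqP; field.
Qed.

End FourierDictionary.

(** * Moments of the number of progressions *)

Section CountMoments.
Context {R : realType} {I P : finType} {k : nat}.
Variable v : P -> 'I_k -> I.
Hypotheses (v_codeg : bounded_codegree v) (k2 : (2 <= k)%N).
Local Notation N := (#|I|%:R : R).
Implicit Types (f : I -> R) (x : {ffun I -> bool}) (e : P).

Definition indicator x : I -> R := fun a => (x a)%:R.

(** Each vertex is taken once, so that means under a product law factor; on 0-1 vectors this agrees
    with the product over positions. *)
Definition edge_indicator e x : R := \prod_(a in codom (v e)) indicator x a.

Lemma indicator_itv x a : 0 <= indicator x a <= 1.
Proof. by rewrite /indicator; case: (x a); rewrite ?ler01 ?lexx. Qed.

Lemma edge_indicatorE e x : \prod_i indicator x (v e i) = edge_indicator e x.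
Proof.
rewrite /edge_indicator; have [/existsP[i xi]|/existsPn xe] := boolP [exists i, ~~ x (v e i)].
  rewrite (bigD1 i)//= [RHS](bigD1 (v e i)) ?codom_f//=.
  by rewrite /indicator (negbTE xi) !mul0r.
rewrite !big1// => [a /codomP[i ->]|i _]; by rewrite /indicator; have := xe i; case: (x _).
Qed.

Lemma ap_count_indicator x : ap_count v (indicator x) = \sum_e edge_indicator e x.
Proof. by apply: eq_bigr => e _; exact: edge_indicatorE. Qed.

(* Degenerate progressions repeat vertices, and repetitions only decrease the
   product of values in [[0, 1]]. *)
Lemma prod_codom_ge f e : (forall a, 0 <= f a <= 1) ->
  \prod_i f (v e i) <= \prod_(a in codom (v e)) f a.
Proof.
move=> f01; rewrite (partition_big (v e) (fun a => a \in codom (v e))) => [/=|i _];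
  last exact: codom_f.
apply: ler_prod => a /codomP[i0 ai0]; apply/andP; split.
  by apply: prodr_ge0 => i _; case/andP: (f01 (v e i)).
rewrite (bigD1 i0) ?ai0//= ler_piMr//; first by case/andP: (f01 (v e i0)).
by rewrite prodr_ile1// => i _; exact: f01.
Qed.

Lemma mean_prod_indicator f (A : pred I) :
  \sum_x prod_weight (bern f) x * \prod_(a | A a) indicator x a = \prod_(a | A a) f a.
Proof.
rewrite (sum_prod_weight_prod_in (sum_bern f) A (fun _ (b : bool) => b%:R)).
by apply: eq_bigr => a _; rewrite big_bool /= /bern mulr1 mulr0 addr0.
Qed.

Definition ap_mean f : R :=
  \sum_x prod_weight (bern f) x * ap_count v (indicator x).

Lemma ap_meanE f : ap_mean f = \sum_e \prod_(a in codom (v e)) f a.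
Proof.
rewrite /ap_mean; under eq_bigr do rewrite ap_count_indicator mulr_sumr.
by rewrite exchange_big; apply: eq_bigr => e _; exact: mean_prod_indicator.
Qed.

Lemma ap_mean_ge f : (forall a, 0 <= f a <= 1) -> ap_count v f <= ap_mean f.
Proof.
by move=> f01; rewrite ap_meanE; apply: ler_sum => e _; exact: prod_codom_ge.
Qed.

Lemma ap_count_cst (p : R) : ap_count v (fun=> p) = p ^+ k * #|P|%:R.
Proof.
rewrite /ap_count /ap_form mulr_natr -sumr_const; apply: eq_bigr => e _.
by rewrite prodr_const card_ord.
Qed.

(** A progression with distinct terms contributes exactly [p ^+ k], a degenerate one at most [1].
    For each pair of positions at most [k N] progressions have equal terms there. *)
Lemma ap_mean_cst_le (p : R) : 0 <= p <= 1 ->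
  ap_mean (fun=> p) <= p ^+ k * #|P|%:R + k%:R ^+ 3 * N.
Proof.
move=> /andP[p0 p1]; rewrite ap_meanE.
apply: (@le_trans _ _ (\sum_e (p ^+ k + \sum_i \sum_(j | j != i) (v e i == v e j)%:R))).
  apply: ler_sum => e _.
  have s0 (A : pred 'I_k) i : 0 <= \sum_(j | A j) (v e i == v e j)%:R :> R.
    by apply: sumr_ge0.
  have [/injectiveP inj|/injectivePn[i [j ij vij]]] := boolP (injectiveb (v e)).
    rewrite prodr_const card_codom// card_ord lerDl sumr_ge0// => i _; exact: s0.
  apply: (@le_trans _ _ 1); first by rewrite prodr_ile1// => *; rewrite p0.
  rewrite (bigD1 i)//= (bigD1 j) 1?eq_sym//= vij eqxx.
  rewrite addrCA -addrA lerDl !addr_ge0 ?exprn_ge0 ?sumr_ge0// => i' _; exact: s0.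
rewrite big_split /= sumr_const -[_ *+ #|P|]mulr_natr lerD2l.
rewrite exchange_big /=.
apply: (@le_trans _ _ (\sum_(i < k) \sum_(j < k) k%:R * N)); last first.
  rewrite !sumr_const card_ord -mulrnA -[leLHS]mulr_natl natrM.
  by rewrite le_eqVlt; apply/orP; left; apply/eqP; ring.
apply: ler_sum => i _; rewrite exchange_big /= big_mkcond; apply: ler_sum => j _ /=.
case: ifP => [ji|_]; last by rewrite mulr_ge0.
rewrite -natr_sum -natrM ler_nat -big_mkcond /=.
rewrite (partition_big (v^~ i) predT)//= mulnC -sum_nat_const; apply: leq_sum => a _.
rewrite sum1_card.
have /v_codeg := negbT (introF eqP (elimN eqP ji)) => /(_ a a); apply: leq_trans.
apply: subset_leq_card; apply/fintype.subsetP => e; rewrite !unfold_in /=.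
by move=> /andP[/eqP <- /eqP ->]; rewrite eqxx.
Qed.

(** Progressions without a common vertex have covariance zero, and the others at most [1]. Each
    progression meets at most [k^3 N] others, counted with positions, and there are at most [k N^2]
    progressions. *)
Lemma variance_ap_count_le f : (forall a, 0 <= f a <= 1) ->
  \sum_x prod_weight (bern f) x * (ap_count v (indicator x) - ap_mean f) ^+ 2
    <= k%:R ^+ 4 * N ^+ 3.
Proof.
move=> f01; set m := ap_mean f; set W := prod_weight (bern f).
have W0 x : 0 <= W x by apply: prod_weight_ge0 => a b; exact: bern_ge0.
have W1 : \sum_x W x = 1 by apply: sum_prod_weight; exact: sum_bern.
pose me e := \prod_(a in codom (v e)) f a.
have X01 e x : 0 <= edge_indicator e x <= 1.
  apply/andP; split; last by apply: prodr_ile1 => a _; exact: indicator_itv.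
  by apply: prodr_ge0 => a _; case/andP: (indicator_itv x a).
have me0 e : 0 <= me e by apply: prodr_ge0 => a _; case/andP: (f01 a).
have mE : m = \sum_e me e by rewrite /m ap_meanE.
have -> : \sum_x W x * (ap_count v (indicator x) - m) ^+ 2 =
    \sum_e \sum_e' (\sum_x W x * (edge_indicator e x * edge_indicator e' x)
      - me e * me e').
  transitivity (\sum_x (W x * (\sum_e edge_indicator e x) ^+ 2
     - 2 * m * (W x * ap_count v (indicator x)) + W x * m ^+ 2)).
    by apply: eq_bigr => x _; rewrite -ap_count_indicator; ring.
  rewrite big_split sumrB /= -mulr_sumr -mulr_suml W1 -/m.
  rewrite -/(ap_mean f) -/m.
  transitivity (\sum_x W x * (\sum_e edge_indicator e x) ^+ 2 - m ^+ 2); first by ring.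
  under [RHS]eq_bigr do rewrite sumrB; rewrite sumrB; congr (_ - _).
    under eq_bigr do rewrite expr2 big_distrlr /= mulr_sumr.
    rewrite exchange_big /=; apply: eq_bigr => e _.
    under eq_bigr do rewrite mulr_sumr; by rewrite exchange_big.
  by rewrite expr2 mE big_distrlr.
have cov e e' : \sum_x W x * (edge_indicator e x * edge_indicator e' x) - me e * me e'
    <= \sum_i \sum_j (v e' j == v e i)%:R.
  have [dis|] := boolP [disjoint codom (v e) & codom (v e')].
    rewrite (_ : _ - _ = 0); first by rewrite sumr_ge0// => i _; rewrite sumr_ge0.
    under eq_bigr => x _ do rewrite /edge_indicator -(bigU _ _ _ dis).
    by rewrite mean_prod_indicator (bigU _ _ _ dis) subrr.
  rewrite disjoint_subset => /fintype.subsetPn[a /codomP[i ai]].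
  rewrite !inE negbK => /codomP[j aj].
  apply: (@le_trans _ _ 1).
    rewrite lerBlDr -[leLHS]addr0 lerD ?mulr_ge0//.
    rewrite -W1; apply: ler_sum => x _; rewrite ler_piMr//.
    by have /andP[? ?] := X01 e x; have /andP[? ?] := X01 e' x; rewrite mulr_ile1.
  rewrite (bigD1 i)//= (bigD1 j)//= -ai -aj eqxx -addrA lerDl addr_ge0 ?sumr_ge0//.
  by move=> *; rewrite sumr_ge0.
have k0 : 0 <= k%:R * N by rewrite mulr_ge0.
apply: (@le_trans _ _ (\sum_e \sum_(i < k) \sum_(j < k) k%:R * N)).
  apply: ler_sum => e _; apply: le_trans (ler_sum _ (fun e' _ => cov e e')) _.
  rewrite exchange_big /=; apply: ler_sum => i _.
  rewrite exchange_big /=; apply: ler_sum => j _.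
  rewrite -natr_sum -natrM ler_nat -big_mkcond /= sum1_card.
  exact: (card_through v_codeg k2 j (v e i)).
rewrite !sumr_const card_ord -!mulrnA -[leLHS]mulr_natl !natrM.
have : #|P|%:R <= k%:R * N ^+ 2 by rewrite -natrX -natrM ler_nat (card_edges v_codeg).
move=> hP; rewrite (_ : k%:R ^+ 4 * N ^+ 3 = k%:R ^+ 3 * N * (k%:R * N ^+ 2)); last by ring.
rewrite (_ : _ * _ * _ = k%:R ^+ 3 * N * #|P|%:R); last by ring.
by rewrite ler_wpM2l// mulr_ge0// exprn_ge0.
Qed.

(** Chebyshev's inequality: the mean is at least [ap_count v f], hence at least [theta + g], and
    failure is a deviation by more than [g]. *)
Lemma bern_Pr_upper_tail_ge f (theta g : R) : (forall a, 0 <= f a <= 1) -> 0 < g ->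
  theta + g <= ap_count v f ->
  1 - k%:R ^+ 4 * N ^+ 3 / g ^+ 2
    <= bern_Pr f (fun x => theta <= ap_count v (indicator x)).
Proof.
move=> f01 g0 hf; have := variance_ap_count_le f01; set m := ap_mean f => var.
have mge : theta + g <= m by apply: le_trans hf _; exact: ap_mean_ge.
have W0 x : 0 <= prod_weight (bern f) x by apply: prod_weight_ge0 => a b; exact: bern_ge0.
have W1 : \sum_x prod_weight (bern f) x = 1 by apply: sum_prod_weight; exact: sum_bern.
rewrite -[X in X - _]W1 (bigID (fun x => theta <= ap_count v (indicator x))) /=.
rewrite -/(bern_Pr f _).
rewrite lerBlDr lerD2l ler_pdivlMr ?exprn_gt0//; apply: le_trans var.
rewrite mulr_suml [leLHS]big_mkcond /=; apply: ler_sum => x _.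
case: ifPn => [|_]; last by rewrite mulr_ge0// sqr_ge0.
rewrite -ltNge => lt; rewrite ler_wpM2l//.
rewrite -[(_ - m) ^+ 2]sqrrN ler_sqr ?nnegrE; lra.
Qed.

Lemma ap_form_upd_le F i z : (forall j a, 0 <= F j a <= 1) ->
  ap_form v (upd F i z) <= k%:R * N * \sum_a `|z a|.
Proof.
move=> F01; rewrite ap_form_upd mulr_sumr; apply: ler_sum => a _.
have d0 : 0 <= ap_dual v F i a.
  by apply: sumr_ge0 => e _; apply: prodr_ge0 => j _; case/andP: (F01 j (v e j)).
have d1 : ap_dual v F i a <= k%:R * N.
  rewrite -natrM; apply: le_trans (_ : #|[pred e | v e i == a]|%:R <= _); last first.
    by rewrite ler_nat card_through.
  rewrite -sum1_card natr_sum; apply: ler_sum => e _.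
  by rewrite prodr_ile1// => j _; exact: F01.
apply: le_trans (ler_norm _) _; rewrite normrM (ger0_norm d0) mulrC.
by rewrite ler_wpM2r.
Qed.

(** Replacing [p] by [f] one position at a time changes the count by at most [k^2 N] times the [L^1]
    distance; Cauchy-Schwarz and the quadratic entropy bound conclude. *)
Lemma entropy_ge f (p D : R) : 0 < p < 1 -> (forall a, 0 <= f a <= 1) ->
  (0 < #|I|)%N -> 0 <= D -> p ^+ k * #|P|%:R + D <= ap_count v f ->
  D ^+ 2 / (4 * k%:R ^+ 4 * N ^+ 3) <= entropy p f.
Proof.
move=> p01 f01 I0 D0 hf; have N0 : 0 < N by rewrite ltr0n.
have k0 : 0 < k%:R :> R by rewrite ltr0n (leq_trans _ k2).
pose S := \sum_a `|f a - p|.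
have DS : D <= k%:R ^+ 2 * N * S.
  have : D <= ap_count v f - ap_count v (fun=> p) by rewrite ap_count_cst; lra.
  move/le_trans; apply; rewrite ap_count_sub.
  have -> : k%:R ^+ 2 * N * S = \sum_(m < k) k%:R * N * S.
    by rewrite sumr_const card_ord -[RHS]mulr_natl; ring.
  apply: ler_sum => m _; apply: ap_form_upd_le => j a.
  by case: ifP => _ //; case/andP: p01 => *; rewrite !ltW.
(* Cauchy-Schwarz, as nonnegativity of the variance of [|f a - p|] over [a]. *)
have cs : S ^+ 2 / N <= \sum_a (f a - p) ^+ 2.
  rewrite -subr_ge0.
  have -> : \sum_a (f a - p) ^+ 2 - S ^+ 2 / N = \sum_a (`|f a - p| - S / N) ^+ 2.
    transitivity (\sum_a ((f a - p) ^+ 2 - 2 * (S / N) * `|f a - p| + (S / N) ^+ 2)).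
      rewrite big_split sumrB /= -mulr_sumr -/S sumr_const -[_ *+ #|I|]mulr_natr.
      by field; rewrite gt_eqF.
    apply: eq_bigr => a _; rewrite -[(f a - p) ^+ 2]real_normK ?num_real//; ring.
  by apply: sumr_ge0 => a _; exact: sqr_ge0.
have ent : (\sum_a (f a - p) ^+ 2) / 4 <= entropy p f.
  by rewrite mulr_suml; apply: ler_sum => a _; exact: relative_entropy_ge.
apply: le_trans ent; apply: (@le_trans _ _ (S ^+ 2 / N / 4)); last first.
  by rewrite ler_pM2r.
rewrite ler_pdivrMr ?mulr_gt0 ?exprn_gt0//.
have -> : S ^+ 2 / N / 4 * (4 * k%:R ^+ 4 * N ^+ 3) = (k%:R ^+ 2 * N * S) ^+ 2.
  by field; rewrite gt_eqF.
by rewrite ler_sqr// nnegrE; exact: le_trans DS.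
Qed.

End CountMoments.

(** * Progressions in a finite subset of an abelian group *)

Section Transfer.
Context {R : realType} {G : zmodType} (k : nat) (A : {fset G}).
Hypothesis k2 : (2 <= k)%N.
Local Notation N := (#|{: A}|%:R : R).

(** The first two terms lie in [B] and determine the pair. *)
Lemma finite_APs (B : {fset G}) : finite_set (APs k B).
Proof.
apply: (@sub_finite_set _ _ ((fun ab : G * G => (ab.1, ab.2 - ab.1)) @`
   ([set` B] `*` [set` B]))); last by apply/finite_image/finite_setX; exact: finite_fset.
move=> [a b] /= ab; exists (a, a + b); last by rewrite /= addrAC subrr add0r.
split=> /=; first by have := ab 0%N (ltnW k2); rewrite mulr0n addr0.
exact: (ab 1%N k2).
Qed.

Definition ap_edges : {fset G * G} := fset_set (APs k A).

Lemma ap_vertex_subproof (e : ap_edges) (i : 'I_k) :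
  (fsval e).1 + (fsval e).2 *+ i \in A.
Proof.
have := fsvalP e; rewrite in_fset_set ?inE; last exact: finite_APs.
by move/(_ i); apply.
Qed.

Definition ap_vertex (e : ap_edges) (i : 'I_k) : A :=
  [` ap_vertex_subproof e i]%fset.

Lemma Tset_edges : Tset k A = #|{: ap_edges}|.
Proof. by rewrite /Tset cardfE. Qed.

Lemma Tfun_ap_count (f : G -> R) :
  Tfun k A f = ap_count ap_vertex (fun a => f (fsval a)).
Proof.
rewrite /Tfun fsbig_finite; last exact: finite_APs.
by rewrite -/ap_edges (big_seq_fsetE _ ap_edges predT).
Qed.

Definition random_subset (x : {ffun A -> bool}) : {fset G} :=
  [fset fsval a | a in [pred a : A | x a]]%fset.

Lemma in_random_subset x (a : A) : (fsval a \in random_subset x) = x a.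
Proof.
by apply/imfsetP/idP => [[b /= bx /val_inj ->]|xa] //; exists a.
Qed.

Lemma Tset_random_subset x :
  (Tset k (random_subset x))%:R = ap_count ap_vertex (indicator x) :> R.
Proof.
have sub : (random_subset x `<=` A)%fset.
  by apply/fsubsetP => g /imfsetP[a _ ->]; exact: fsvalP.
have -> : Tset k (random_subset x) = #|` [fset ab in ap_edges |
    [forall i : 'I_k, (ab.1 + ab.2 *+ i)%R \in random_subset x]]%fset|.
  congr (#|` _|); apply/fsetP => ab; rewrite !inE !in_fset_set ?inE; try exact: finite_APs.
  apply/idP/andP => [h|[_ /forallP h]].
    split; last by apply/forallP => i; move: h; rewrite inE => /(_ i (ltn_ord i)).
    by rewrite inE => i ik; move: h; rewrite inE => /(_ i ik); exact: (fsubsetP sub).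
  by rewrite inE => i ik; exact: (h (Ordinal ik)).
rewrite card_fset_sum1 -big_fset_condE natr_sum big_mkcond /=.
rewrite (big_seq_fsetE _ ap_edges predT) /=; apply: eq_bigr => e _.
case: ifPn => [/forallP h|/forallPn[i h]].
  by rewrite big1// => i _; rewrite /indicator -in_random_subset h.
rewrite (bigD1 i)//= /indicator -in_random_subset.
by rewrite (negbTE h) mul0r.
Qed.

Lemma sum_fpowerset (H : {fset G} -> R) :
  \sum_(B <- fpowerset A) H B = \sum_(x : {ffun A -> bool}) H (random_subset x).
Proof.
have inj : injective random_subset.
  by move=> x y xy; apply/ffunP => a; rewrite -!in_random_subset xy.
rewrite -[RHS](big_map random_subset predT) /=.
apply: perm_big; apply: uniq_perm.
- exact: fset_uniq.
- by rewrite map_inj_uniq// index_enum_uniq.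
move=> B; rewrite fpowersetE; apply/idP/mapP => [BA|[x _ ->]].
  exists [ffun a : A => fsval a \in B]; first by rewrite mem_index_enum.
  apply/fsetP => g; apply/idP/imfsetP => [gB|[a /= ha ->]].
    have gA := fsubsetP BA _ gB; exists [` gA]%fset => //=.
    by rewrite unfold_in /= ffunE.
  by move: ha; rewrite unfold_in /= ffunE.
by apply/fsubsetP => g /imfsetP[a _ ->]; exact: fsvalP.
Qed.

Lemma random_subset_lawE (p : R) x :
  random_subset_law p A (random_subset x) = prod_weight (bern (fun=> p)) x.
Proof.
rewrite /random_subset_law (big_seq_fsetE _ A predT) /=.
by apply: eq_bigr => a _; rewrite in_random_subset.
Qed.

Lemma upper_tail_rateE (p delta : R) : upper_tail_rate k A p delta =
  (- lne (bern_Pr (fun=> p) (fun x : {ffun A -> bool} =>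
      (1 + delta) * ap_mean ap_vertex (fun=> p)
        <= ap_count ap_vertex (indicator x)))%:E)%E.
Proof.
have Ex : random_subset_Ex p A (fun C => (Tset k C)%:R) = ap_mean ap_vertex (fun=> p).
  rewrite /random_subset_Ex sum_fpowerset; apply: eq_bigr => x _.
  by rewrite random_subset_lawE Tset_random_subset.
rewrite /upper_tail_rate Ex; congr (- lne _%:E)%E.
rewrite /random_subset_Pr big_mkcond sum_fpowerset -big_mkcond /=.
by apply: eq_big => [x|x _]; rewrite ?Tset_random_subset ?random_subset_lawE.
Qed.

Lemma phi_le (p delta : R) (y : A -> R) : (forall a, 0 <= y a <= 1) ->
  (1 + delta) * p ^+ k * #|{: ap_edges}|%:R <= ap_count ap_vertex y ->
  (phi k A p delta <= (entropy p y)%:E)%E.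
Proof.
(* [phi] ranges over functions on the whole group, so [y] is extended by [0]. *)
move=> y01 hy; pose f g := oapp y 0 (insub g : option A).
have fE a : f (fsval a) = y a by rewrite /f valK.
apply: ereal_inf_lbound; exists f => /=.
  split=> [g gA|]; first by have := fE [` gA]%fset => /= ->.
  rewrite Tset_edges Tfun_ap_count.
  by under [X in ap_count _ X]funext => a do rewrite fE.
rewrite /entropy (big_seq_fsetE _ A predT) /=.
by congr _%:E; apply: eq_bigr => a _; rewrite fE.
Qed.

Lemma phi_ge (p delta : R) (c : \bar R) :
  (forall y : A -> R, (forall a, 0 <= y a <= 1) ->
     (1 + delta) * p ^+ k * #|{: ap_edges}|%:R <= ap_count ap_vertex y ->
     (c <= (entropy p y)%:E)%E) ->
  (c <= phi k A p delta)%E.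
Proof.
move=> h; apply: le_ereal_inf_tmp => _ [f [f01 fT] <-].
rewrite (big_seq_fsetE _ A predT) /=.
apply: (h (fun a => f (fsval a))) => [a|]; first by apply: f01; exact: fsvalP.
by rewrite -Tset_edges -Tfun_ap_count.
Qed.

Hypothesis codeg : bounded_codegree ap_vertex.
Hypothesis A_gt0 : (0 < #|{: A}|)%N.
Variables (p delta eta : R).
Hypotheses (p01 : 0 < p < 1) (delta_gt0 : 0 < delta).
Local Notation E := (#|{: ap_edges}|%:R : R).

(** The loss in the count is paid by lowering [delta] to [(1 - eta) * delta]; the coding cost is at
    most [eta] times a lower bound for [phi], which turns the additive error into a factor. *)
Lemma phi_rate_le {D : finType} (vec : D -> A -> R) (gain eps : R) (n : nat) :
  0 <= eta <= 1 -> N < n%:R * gain ->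
  (forall z, detectable ap_vertex eps z -> exists d,
     \sum_a (z a - vec d a) ^+ 2 <= \sum_a z a ^+ 2 - gain) ->
  k%:R * (2 * eps * N ^+ 2) <= eta * delta * p ^+ k * E ->
  n%:R * ln (#|D|.+1)%:R
    <= eta * (((1 - eta) * delta * p ^+ k * E) ^+ 2 / (4 * k%:R ^+ 4 * N ^+ 3)) ->
  ((1 - eta)%:E * phi k A p ((1 - eta) * delta) <= upper_tail_rate k A p delta)%E.
Proof.
move=> /andP[eta0 eta1] nN step heps hD; rewrite upper_tail_rateE.
set Ev := fun x : {ffun A -> bool} => _; set Q := bern_Pr _ Ev.
(* An event of probability zero has rate [+oo]. *)
have [Q0|Q0] := leP Q 0; first by rewrite /lne Q0 leey.
have -> : lne Q%:E = (ln Q)%:E by rewrite /lne leNgt Q0.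
 set D0 := _ ^+ 2 / _ in hD.
have p0 : 0 < p by case/andP: p01.
have mean_ge : p ^+ k * E <= ap_mean ap_vertex (fun=> p).
  rewrite -(ap_count_cst ap_vertex p); apply: ap_mean_ge => _; case/andP: p01.
  by move=> *; rewrite !ltW.
have [y [y01 ye yT]] := entropy_le_upper_tail p01 nN step (fun x => id) Q0.
have feas : (1 + (1 - eta) * delta) * p ^+ k * E <= ap_count ap_vertex y.
  apply: le_trans yT.
  have : (1 + delta) * (p ^+ k * E) <= (1 + delta) * ap_mean ap_vertex (fun=> p).
    by rewrite ler_pM2l// addr_gt0.
  move: heps; set T := (1 + delta) * ap_mean _ _; set K := k%:R * _; set q := p ^+ k; lra.
have up := phi_le y01 feas.
have lo : (D0%:E <= phi k A p ((1 - eta) * delta))%E.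
  apply: phi_ge => f f01 fT; rewrite lee_fin.
  apply: (entropy_ge codeg k2 p01 f01 A_gt0).
    by rewrite !mulr_ge0 ?subr_ge0 ?exprn_ge0 ?(ltW delta_gt0) ?(ltW p0).
  by move: fT; set q := p ^+ k; lra.
(* Feasibility of [y] and the entropy lower bound make [phi] finite, so that the rest is real
   arithmetic. *)
have fin : phi k A p ((1 - eta) * delta) \is a fin_num.
  by rewrite fin_numElt (lt_le_trans (ltNyr D0) lo) (le_lt_trans up (ltry _)).
move: up lo; rewrite -(fineK fin) !lee_fin; set ph := fine _ => up lo.
have : eta * D0 <= eta * ph by rewrite ler_wpM2l.
move: ye hD; rewrite -/Q; set L := n%:R * _; set H := entropy _ _ in up *.
set l := ln Q; move=> *; lra.
Qed.

(** A point feasible for [(1 + eta) * delta] exceeds the threshold by [g], even after the degenerate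
    progressions in the mean are allowed for. Under its product law the event has probability at
    least [1 - eta / 4], and the additive [1] of data processing is at most [eta / 4] of the
    entropy. *)
Lemma rate_le_phi (g : R) : 0 < eta <= 1 -> 0 < g ->
  g <= eta * delta * p ^+ k * E - (1 + delta) * (k%:R ^+ 3 * N) ->
  k%:R ^+ 4 * N ^+ 3 / g ^+ 2 <= eta / 4 ->
  1 <= eta / 4 * ((delta * p ^+ k * E) ^+ 2 / (4 * k%:R ^+ 4 * N ^+ 3)) ->
  (upper_tail_rate k A p delta <= (1 + eta)%:E * phi k A p ((1 + eta) * delta))%E.
Proof.
move=> /andP[eta0 eta1] g0 hg hc h1; rewrite upper_tail_rateE.
set Ev := fun x : {ffun A -> bool} => _; set Q := bern_Pr _ Ev.
have p0 : 0 < p by case/andP: p01.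
have e1 : 0 < 1 + eta by rewrite addr_gt0.
rewrite -lee_pdivrMl//; apply: phi_ge => y y01 yT.
have mean_le : (1 + delta) * ap_mean ap_vertex (fun=> p)
    <= (1 + delta) * (p ^+ k * E + k%:R ^+ 3 * N).
  by rewrite ler_pM2l ?addr_gt0// ap_mean_cst_le//; case/andP: p01 => *; rewrite !ltW.
have Tg : (1 + delta) * ap_mean ap_vertex (fun=> p) + g <= ap_count ap_vertex y.
  apply: le_trans yT; move: mean_le hg; set q := p ^+ k; set T := (1 + delta) * ap_mean _ _.
  set K := k%:R ^+ 3 * N; lra.
have Q'ge := bern_Pr_upper_tail_ge codeg k2 y01 g0 Tg.
rewrite -/Ev in Q'ge; set Q' := bern_Pr y Ev in Q'ge.
have Q'1 : 1 - eta / 4 <= Q' by apply: le_trans Q'ge; rewrite lerD2l lerN2.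
have Q'0 : 0 < Q' by apply: lt_le_trans Q'1; lra.
have [Q0 hQ] := entropy_ge_Pr p01 y01 Q'0.
rewrite -/Q -/Q' in Q0 hQ.
have -> : lne Q%:E = (ln Q)%:E by rewrite /lne leNgt Q0.
rewrite lee_pdivrMl// -EFinN -EFinM lee_fin.
have Hge : (delta * p ^+ k * E) ^+ 2 / (4 * k%:R ^+ 4 * N ^+ 3) <= entropy p y.
  apply: (entropy_ge codeg k2 p01 y01 A_gt0).
    by rewrite !mulr_ge0 ?exprn_ge0 ?(ltW delta_gt0) ?(ltW p0).
  apply: le_trans yT; rewrite mulrDl mul1r mulrDl lerD2l -!(mulrA (1 + eta)).
  have : 0 <= delta * p ^+ k * E by rewrite !mulr_ge0 ?exprn_ge0 ?(ltW delta_gt0) ?(ltW p0).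
  by move=> h; rewrite [leRHS]mulrDl mul1r lerDl mulr_ge0// ltW.
set H := entropy p y in hQ Hge *; set D0 := _ / (4 * _ * _) in h1 Hge.
have hH : 1 <= eta / 4 * H by apply: le_trans h1 _; rewrite ler_wpM2l// divr_ge0// ltW.
have H0 : 0 <= H.
  by rewrite -(pmulr_rge0 _ (_ : 0 < eta / 4)) ?divr_gt0//; exact: le_trans hH.
have [l0|l0] := leP 0 (- ln Q); last first.
  by apply: le_trans (ltW l0) _; rewrite mulr_ge0// ltW.
have : (1 - eta / 4) * - ln Q <= (1 + eta / 4) * H.
  have : (1 - eta / 4) * - ln Q <= Q' * - ln Q by rewrite ler_wpM2r.
  move=> h; rewrite [leRHS]mulrDl mul1r; apply: le_trans h _.
  by apply: le_trans hQ _; rewrite lerD2l.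
(* The two factors of [H] differ by [eta / 2 - eta^2 / 4], which is nonnegative as [eta <= 1]. *)
have key : (1 + eta / 4) * H <= (1 - eta / 4) * ((1 + eta) * H).
  by rewrite mulrA ler_wpM2r//; nra.
by move=> h; have := le_trans h key; rewrite ler_pM2l//; lra.
Qed.

End Transfer.

(** * The two settings *)

Section Vertices.
Context {G : zmodType} {k : nat} {A : {fset G}}.
Hypothesis k2 : (2 <= k)%N.
Local Notation v := (ap_vertex (A := A) k2).

(** With terms [x] and [y] in positions [i < j], the common difference [b] solves
    [b *+ (j - i) = y - x] and determines the progression. *)
Lemma ap_vertex_codegree :
  (forall d (c : G) (s : seq G), (0 < d < k)%N -> uniq s ->
     {in s, forall b, b *+ d = c} -> (size s <= k)%N) ->
  bounded_codegree v.
Proof.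
move=> tor.
have main (i j : 'I_k) x y : (i < j)%N ->
    (#|[pred e | (v e i == x) && (v e j == y)]| <= k)%N.
  move=> ij; set B := [pred e | _].
  rewrite cardE -(size_map (fun e : ap_edges k A => (fsval e).2)).
  have inB e : e \in enum B -> (fsval e).1 + (fsval e).2 *+ i = fsval x /\
      (fsval e).1 + (fsval e).2 *+ j = fsval y.
    by rewrite mem_enum !inE => /andP[/eqP <- /eqP <-].
  apply: (tor (j - i)%N (fsval y - fsval x)).
  - by rewrite subn_gt0 ij (leq_ltn_trans (leq_subr _ _)).
  - rewrite map_inj_in_uniq ?enum_uniq// => e e' /inB[e1 _] /inB[e1' _] e2.
    apply: val_inj; rewrite /= [fsval e]surjective_pairing [fsval e']surjective_pairing.
    by move: e1; rewrite -e1' e2 => /addIr ->.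
  - move=> b /mapP[e /inB[<- <-] ->].
    by rewrite mulrnBr 1?ltnW// opprD addrACA subrr add0r.
move=> i j ij x y; have [lt|lt|/val_inj e] := ltngtP i j.
- exact: main.
- apply: leq_trans (main j i y x lt); apply: eq_leq; apply: eq_card => e.
  by rewrite !inE andbC.
- by rewrite e eqxx in ij.
Qed.

Lemma card_ap_edges_ge (q : nat) (h1 h2 : 'I_q -> G) :
  injective h1 -> injective h2 ->
  (forall i j l, (l < k)%N -> h1 i + h2 j *+ l \in A) ->
  (q ^ 2 <= #|{: ap_edges k A}|)%N.
Proof.
move=> i1 i2 hA.
have mem (ij : 'I_q * 'I_q) : (h1 ij.1, h2 ij.2) \in ap_edges k A.
  by rewrite in_fset_set ?inE; [move=> l lk; exact: hA | exact: finite_APs].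
pose g ij : ap_edges k A := [` mem ij]%fset.
have gI : injective g.
  by move=> [i j] [i' j'] /(congr1 (fun e => fsval e)) /= [/i1 -> /i2 ->].
by have := leq_card g gI; rewrite card_prod card_ord mulnn.
Qed.

End Vertices.

(** * Three-term progressions as solutions of an equation *)

Section Progressions3.
Context {R : realType} {G : zmodType} {A : {fset G}}.
Hypothesis k2 : (2 <= 3)%N.
Local Notation v := (ap_vertex (A := A) k2).
Variables (M : nat) (e : A -> R[i]).
Hypotheses (M_gt0 : (0 < M)%N) (A_gt0 : (0 < #|{: A}|)%N).
Hypotheses (e_root : forall a, e a ^+ M = 1) (e_inj : injective e).
Hypothesis e_mid : forall a b c : A,
  e a * e c = e b ^+ 2 <-> fsval a + fsval c = fsval b + fsval b.

(** Triples in [A] with [a + c = b + b] are exactly the progressions, with start [a] and difference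
    [b - a]. *)
Lemma fourier_dictionary3 (eps : R) (z : A -> R) : 0 < eps -> detectable v eps z ->
  exists d, \sum_a (z a - fourier_vec (M := M) e (eps / 4) d a) ^+ 2
    <= \sum_a z a ^+ 2 - eps ^+ 2 / 16 * #|{: A}|%:R.
Proof.
have e0 a : e a != 0.
  apply/eqP => h; have := e_root a.
  by rewrite h expr0n gtn_eqF// => /eqP; rewrite eq_sym oner_eq0.
have mid a b c : e a * e b ^- 2 * e c = 1 <-> fsval a + fsval c = fsval b + fsval b.
  rewrite -e_mid; have b0 : e b ^+ 2 != 0 by rewrite expf_neq0.
  by rewrite mulrAC; split=> [h|->]; [rewrite -[LHS](divfK b0) h mul1r | rewrite divff].
have v0 q : fsval (v q 0) = (fsval q).1 by rewrite /= mulr0n addr0.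
have v1 q : fsval (v q 1) = (fsval q).1 + (fsval q).2 by [].
have v2 q : fsval (v q (inord 2)) = (fsval q).1 + (fsval q).2 *+ 2 by rewrite /= inordK.
move=> eps0; apply: fourier_dictionary => //.
- by move=> q; apply/mid; rewrite v0 v1 v2 mulr2n [RHS]addrACA [LHS]addrA.
- move=> q q' vq; have h0 : fsval (v q 0) = fsval (v q' 0) by rewrite vq.
  have h1 : fsval (v q 1) = fsval (v q' 1) by rewrite vq.
  rewrite !v0 in h0; rewrite !v1 in h1; apply: val_inj.
  rewrite /= [fsval q]surjective_pairing [fsval q']surjective_pairing.
  by move: h1; rewrite h0 => /addrI ->.
move=> a b c /mid h.
have hq : (fsval a, fsval b - fsval a) \in ap_edges 3 A.
  rewrite in_fset_set ?inE; last exact: finite_APs.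
  move=> [|[|[|//]]] _ /=; first by rewrite mulr0n addr0 fsvalP.
    by rewrite mulr1n addrC subrK fsvalP.
  rewrite mulr2n addrA (addrC (fsval a)) subrK addrA -h addrAC subrr add0r.
  exact: fsvalP.
exists [` hq]%fset; split; apply: val_inj => /=.
- by rewrite mulr0n addr0.
- by rewrite mulr1n addrC subrK.
by rewrite inordK// mulr2n addrA (addrC (fsval a)) subrK addrA -h addrAC subrr add0r.
Qed.

End Progressions3.

Section Settings.
Variable S : setting.
Implicit Types (N k : nat).

Lemma card_Omega N : (0 < N)%N -> #|{: Omega S N}| = N.
Proof.
move=> N0; rewrite -cardfE; case: S => /=.
  rewrite card_imfset /=; last by move=> i j [].
  by rewrite undup_id ?iota_uniq// size_iota.
rewrite card_imfset//= -cardE card_ord prednK//.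
Qed.

(** Integers have no torsion, so [b *+ d = c] has at most one solution. In the cyclic group two
    solutions have the same [b * d] modulo the order, so they are told apart by the quotient, which
    takes fewer than [d + 1] values. *)
Lemma Omega_codegree N k (k2 : (2 <= k)%N) :
  bounded_codegree (ap_vertex (A := Omega S N) k2).
Proof.
apply: ap_vertex_codegree; case: S => /= d c s /andP[d0 dk] us hs.
  apply: leq_trans (ltnW k2); case: s us hs => [//|b [//|b' s]] /= /andP[nb _] hs.
  have hb := hs b (mem_head _ _); have hb' : b' *+ d = c by apply: hs; rewrite !inE eqxx orbT.
  have /eqP : (b - b') *+ d = 0 by rewrite mulrnBl hb hb' subrr.
  rewrite mulrn_eq0 gtn_eqF//= subr_eq0 => /eqP bb.
  by rewrite bb inE eqxx in nb.
apply: leq_trans (ltnW dk).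
rewrite -(size_map (fun b : 'I_N.-1.+1 => (b * d) %/ N.-1.+1)%N) -[leqRHS](size_iota 0).
apply: uniq_leq_size => [|q /mapP[b _ ->]].
  rewrite map_inj_in_uniq// => b b' /hs hb /hs hb' eqd; apply: val_inj => /=.
  have e1 : ((b * d) %% N.-1.+1 = (b' * d) %% N.-1.+1)%N.
    by move: hb; rewrite -hb' !Zp_mulrn => /(congr1 val).
  have : (b * d = b' * d)%N by rewrite (divn_eq (b * d) N.-1.+1) eqd e1 -divn_eq.
  by move/eqP; rewrite eqn_pmul2r// => /eqP.
by rewrite mem_iota /= add0n ltn_divLR// mulnC ltn_pmul2l.
Qed.

(** In the interval, starts in [[1, q]] and differences in [[0, q - 1]] with [q = N %/ k] keep every
    term at most [q k <= N]; in the cyclic group these choices stay distinct. *)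
Lemma Omega_edges_ge N k (k2 : (2 <= k)%N) :
  ((N %/ k) ^ 2 <= #|{: ap_edges k (Omega S N)}|)%N.
Proof.
have k0 : (0 < k)%N by apply: ltnW.
have qk := leq_trunc_div N k.
case: S => /=.
  apply: (card_ap_edges_ge k2 (h1 := fun i => Posz i.+1) (h2 := fun i => Posz i)).
  - by move=> i j [/val_inj].
  - by move=> i j [/val_inj].
  move=> i j l lk; apply/imfsetP; exists (i.+1 + j * l)%N; last first.
    by rewrite PoszD PoszM -mulr_natr natz.
  rewrite /= mem_iota; have := ltn_ord i; have := ltn_ord j; nia.
apply: (card_ap_edges_ge k2 (h1 := fun i => inZp i) (h2 := fun i => inZp i)).
- move=> i j /(congr1 val) /=; have := ltn_ord i; have := ltn_ord j => hj hi.
  by rewrite !modn_small; [move/val_inj | nia | nia].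
- move=> i j /(congr1 val) /=; have := ltn_ord i; have := ltn_ord j => hj hi.
  by rewrite !modn_small; [move/val_inj | nia | nia].
by move=> i j l lk; apply/imfsetP; eexists.
Qed.

(** On the interval, order [2 N] prevents wraparound: [i + l] and [2 j] both lie in [[2, 2 N]],
    where congruence modulo [2 N] is equality. On the cyclic group a primitive [N]-th root
    suffices. *)
Lemma Omega_phase (R : realType) N : (0 < N)%N ->
  exists M (e : Omega S N -> R[i]), [/\ (0 < M <= 2 * N)%N,
    forall a, e a ^+ M = 1, injective e &
    forall a b c : Omega S N,
      e a * e c = e b ^+ 2 <-> fsval a + fsval c = fsval b + fsval b].
Proof.
move=> N0; case: S => /=.
  have M0 : (0 < 2 * N)%N by rewrite muln_gt0.
  have [w pw] := exists_prim_root (R := R) M0.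
  have itv (a : Omega IntegerInterval N) : exists2 i, (0 < i <= N)%N & fsval a = Posz i.
    have /imfsetP[i /= hi ->] := fsvalP a; exists i => //.
    by move: hi; rewrite mem_iota add1n ltnS.
  exists (2 * N)%N, (fun a => w ^+ `|fsval a|%N); split.
  - by rewrite M0 leqnn.
  - by move=> a; rewrite exprAC (prim_expr_order pw) expr1n.
  - move=> a b /eqP; rewrite (eq_prim_root_expr pw) => h; apply: val_inj => /=.
    move: h; have [i hi ->] := itv a; have [j hj ->] := itv b.
    by rewrite !absz_nat !modn_small; [move=> /eqP -> | lia | lia].
  move=> a b c; have [i hi ->] := itv a; have [j hj ->] := itv b; have [l hl ->] := itv c.
  rewrite !absz_nat -exprD -exprM; split=> [/eqP|].
    rewrite (eq_prim_root_expr pw) => h; have : (i + l = j + j)%N.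
      move: h; have [h1|h1] := ltnP (i + l) (2 * N); have [h2|h2] := ltnP (j * 2) (2 * N).
      - by rewrite !modn_small// => /eqP; lia.
      - have -> : (j * 2 = 2 * N)%N by lia.
        by rewrite modnn modn_small// => /eqP; lia.
      - have -> : (i + l = 2 * N)%N by lia.
        by rewrite modnn modn_small// => /eqP; lia.
      - lia.
    by move=> hh; rewrite -!PoszD hh.
  by rewrite -!PoszD => -[->]; rewrite addnn muln2.
have [w pw] := exists_prim_root (R := R) (ltn0Sn N.-1).
have NE : (N.-1.+1 = N)%N by rewrite prednK.
exists N.-1.+1, (fun a => w ^+ (val (fsval a))); split.
- by rewrite /= NE leq_pmull.
- by move=> a; rewrite exprAC (prim_expr_order pw) expr1n.
- move=> a b /eqP; rewrite (eq_prim_root_expr pw).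
  rewrite !modn_small; [|exact: ltn_ord|exact: ltn_ord].
  by move=> /eqP /val_inj /val_inj.
move=> a b c; rewrite -exprD -exprM; split=> [/eqP|/(congr1 val) /= h].
  rewrite (eq_prim_root_expr pw) => /eqP h; apply: val_inj; rewrite /= h.
  by rewrite muln2 addnn.
by apply/eqP; rewrite (eq_prim_root_expr pw) h muln2 addnn.
Qed.

End Settings.

(** * Asymptotics *)

Section FiniteBounds.
Context {R : realType} (S : setting) (k : nat) (k2 : (2 <= k)%N) (N : nat).
Hypothesis kN : (k <= N)%N.
Variables (p delta eta W L : R).
Hypotheses (p01 : 0 < p < 1) (delta_gt0 : 0 < delta) (eta_itv : 0 < eta <= 1 / 2).
Hypothesis W_gt0 : 0 < W.
Local Notation n := (N%:R : R).
Local Notation K := (k%:R : R).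
Local Notation A := (Omega S N).

(* A lower bound for the number of progressions divided by [N ^ 2]. *)
Definition density : R := (4 * k%:R ^+ 2)^-1.

(** Chosen so that the covering loss [k * (2 * eps * N^2)] equals
    [eta * delta * p^k * density * N^2]. *)
Definition error_level (p delta eta : R) : R :=
  eta * (delta * p ^+ k) * density / (2 * k%:R).

Let lambda := delta * p ^+ k.
Let eps := error_level p delta eta.

Let k0 : (0 < k)%N. Proof. exact: ltnW. Qed.
Let N0 : (0 < N)%N. Proof. exact: leq_trans kN. Qed.
Let K0 : 0 < K. Proof. by rewrite ltr0n. Qed.
Let n0 : 0 < n. Proof. by rewrite ltr0n. Qed.
Let d0 : 0 < density. Proof. by rewrite invr_gt0 mulr_gt0// exprn_gt0. Qed.
Let l0 : 0 < lambda.
Proof. by case/andP: p01 => p0 _; rewrite mulr_gt0// exprn_gt0. Qed.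
Let e0 : 0 < eta. Proof. by case/andP: eta_itv. Qed.
Let eta_half : 1 / 2 <= 1 - eta. Proof. by case/andP: eta_itv; lra. Qed.
Let eps0 : 0 < eps.
Proof. by apply: divr_gt0; apply: mulr_gt0 => //; exact: mulr_gt0. Qed.

Lemma density_le : density * n ^+ 2 <= #|{: ap_edges k A}|%:R.
Proof.
have h := Omega_edges_ge S N k2; apply: le_trans (_ : ((N %/ k) ^ 2)%:R <= _); last first.
  by rewrite ler_nat.
have hN : (N <= (2 * k) * (N %/ k))%N.
  apply: ltnW; apply: leq_trans (ltn_ceil N k0) _; rewrite [leqRHS]mulnAC leq_mul2r.
  by rewrite mul2n -addnn -addn1 leq_add2l divn_gt0// kN orbT.
have {}hN : n <= 2 * K * (N %/ k)%:R by rewrite -natrM -natrM ler_nat.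
rewrite natrX /density mulrC ler_pdivrMr ?mulr_gt0 ?exprn_gt0//.
have -> : (N %/ k)%:R ^+ 2 * (4 * K ^+ 2) = (2 * K * (N %/ k)%:R) ^+ 2 by ring.
by rewrite ler_sqr ?nnegrE// ?mulr_ge0// ltW.
Qed.

(** The three numerical conditions control, in order, the coding cost, the degenerate progressions,
    and the variance together with the additive constant of data processing. *)
Lemma rate_sandwich (D : finType) (vec : D -> A -> R) :
  eps ^+ 2 <= W ->
  (forall z, detectable (ap_vertex (A := A) k2) eps z -> exists d,
     \sum_a (z a - vec d a) ^+ 2 <= \sum_a z a ^+ 2 - eps ^+ 2 / W * n) ->
  ln (#|D|.+1)%:R <= L ->
  128 * W * K ^+ 6 / density ^+ 4 * L <= eta ^+ 3 * lambda ^+ 4 * n ->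
  2 * (1 + delta) * K ^+ 3 <= eta * lambda * density * n ->
  16 * K ^+ 4 <= eta ^+ 3 * lambda ^+ 2 * density ^+ 2 * n ->
  ((1 - eta)%:E * phi k A p ((1 - eta) * delta) <= upper_tail_rate k A p delta
    <= (1 + eta)%:E * phi k A p ((1 + eta) * delta))%E.
Proof.
move=> epsW step DL h1 h2 h3.
have cA : #|{: A}| = N := card_Omega S N0.
have codeg := @Omega_codegree S N k k2.
have A0 : (0 < #|{: A}|)%N by rewrite cA.
have Ege := density_le; set E := #|{: ap_edges k A}|%:R in Ege.
case/andP: eta_itv => _ e1.
have eta1 : eta <= 1 by apply: le_trans e1 _; rewrite ler_pdivrMr// mul1r ler1n.
have p0 : 0 < p by case/andP: p01.
have lE : lambda * (density * n ^+ 2) <= lambda * E by rewrite ler_pM2l.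
have E0 : 0 <= E by exact: ler0n.
have eps2 : 0 < eps ^+ 2 by rewrite exprn_gt0.
have base : (lambda * density) ^+ 2 * n / (4 * K ^+ 4) <=
    (lambda * E) ^+ 2 / (4 * K ^+ 4 * n ^+ 3).
  have -> : (lambda * density) ^+ 2 * n / (4 * K ^+ 4)
      = (lambda * (density * n ^+ 2)) ^+ 2 / (4 * K ^+ 4 * n ^+ 3).
    by field; rewrite !gt_eqF.
  rewrite ler_pM2r; last by rewrite invr_gt0 !mulr_gt0 ?exprn_gt0.
  by rewrite ler_sqr ?nnegrE ?(le_trans _ lE) ?mulr_ge0// ?exprn_ge0// ltW.
apply/andP; split.
  (* The number of greedy steps: an integer above [W / eps^2], and at most twice that since
     [eps^2 <= W]. *)
  pose s := (Num.trunc (W / eps ^+ 2)).+1.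
  have q1 : 1 <= W / eps ^+ 2 by rewrite ler_pdivlMr// mul1r.
  have /andP[s1 s2] := trunc_itv (le_trans ler01 q1).
  apply: (phi_rate_le codeg A0 p01 delta_gt0 (n := s) _ _ step).
  - by rewrite ltW.
  - rewrite cA mulrA ltr_pMl// -(ltr_pM2r (_ : 0 < W / eps ^+ 2)) ?divr_gt0// mul1r.
    by rewrite -mulrA -(invf_div W) mulVf ?mulr1// gt_eqF// divr_gt0.
  - rewrite cA /eps /error_level -/lambda -/E.
    have -> : eta * delta * p ^+ k * E = eta * (lambda * E) by rewrite /lambda; ring.
    have -> : K * (2 * (eta * lambda * density / (2 * K)) * n ^+ 2)
        = eta * (lambda * (density * n ^+ 2)) by field; rewrite gt_eqF.
    by rewrite ler_pM2l.
  rewrite cA -/E.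
  have sL : s%:R * ln (#|D|.+1)%:R <= 2 * W / eps ^+ 2 * L.
    have s3 : s%:R <= 2 * W / eps ^+ 2.
      by rewrite -mulrA [leRHS]mulr_natl mulr2n /s -natr1 lerD.
    by apply: ler_pM => //; rewrite ln_ge0// ler1n.
  apply: le_trans sL _.
  (* Here 128 is [8 * 16]: [2 W / eps^2] is [8 W K^2 / (eta lambda density)^2], and it is compared
     with [eta (lambda density)^2 n / (16 K^4)], in which a factor [1 / 4] pays for
     [(1 - eta)^2]. *)
  have -> : 2 * W / eps ^+ 2 * L = (128 * W * K ^+ 6 / density ^+ 4 * L)
      * (density ^+ 2 / (16 * K ^+ 4 * eta ^+ 2 * lambda ^+ 2)).
    by rewrite /eps /error_level -/lambda; field; rewrite !gt_eqF.
  apply: (@le_trans _ _ (eta ^+ 3 * lambda ^+ 4 * n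
      * (density ^+ 2 / (16 * K ^+ 4 * eta ^+ 2 * lambda ^+ 2)))).
    by rewrite ler_wpM2r// divr_ge0 ?mulr_ge0 ?exprn_ge0 ?ltW.
  have -> : eta ^+ 3 * lambda ^+ 4 * n *
      (density ^+ 2 / (16 * K ^+ 4 * eta ^+ 2 * lambda ^+ 2))
      = eta * (4^-1 * ((lambda * density) ^+ 2 * n / (4 * K ^+ 4))).
    by field; rewrite !gt_eqF.
  rewrite ler_pM2l//.
  have -> : ((1 - eta) * delta * p ^+ k * E) ^+ 2 / (4 * K ^+ 4 * n ^+ 3)
     = (1 - eta) ^+ 2 * ((lambda * E) ^+ 2 / (4 * K ^+ 4 * n ^+ 3)).
    by rewrite /lambda; field; rewrite !gt_eqF.
  apply: ler_pM => //; first by rewrite divr_ge0 ?mulr_ge0 ?sqr_ge0 ?exprn_ge0 ?ltW.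
  have -> : 4^-1 = (1 / 2) ^+ 2 :> R by field.
  by rewrite ler_sqr ?nnegrE// ?(le_trans _ eta_half).
(* Half of the guaranteed excess serves as the margin for Chebyshev; the other half absorbs the
   degenerate progressions. *)
pose g := eta * lambda * density * n ^+ 2 / 2.
have g0 : 0 < g by rewrite divr_gt0// ?mulr_gt0 ?exprn_gt0.
apply: (rate_le_phi codeg A0 p01 delta_gt0 (g := g)) => //.
- by rewrite e0.
- rewrite cA -/E.
  have : (1 + delta) * (K ^+ 3 * n) <= g.
    rewrite /g ler_pdivlMr// [leRHS](_ : _ = eta * lambda * density * n * n); last by ring.
    by rewrite [leLHS](_ : _ = 2 * (1 + delta) * K ^+ 3 * n) ?ler_pM2r//; ring.
  have -> : eta * delta * p ^+ k * E = eta * (lambda * E) by rewrite /lambda; ring.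
  have : eta * (lambda * (density * n ^+ 2)) <= eta * (lambda * E) by rewrite ler_pM2l.
  have -> : eta * (lambda * (density * n ^+ 2)) = g + g by rewrite /g; field.
  by move=> hE hg; rewrite lerBrDr (le_trans _ hE)// lerD2l.
- rewrite cA ler_pdivrMr ?exprn_gt0//.
  have -> : eta / 4 * g ^+ 2 = eta ^+ 3 * lambda ^+ 2 * density ^+ 2 * n * (n ^+ 3 / 16).
    by rewrite /g; field.
  rewrite [leLHS](_ : _ = 16 * K ^+ 4 * (n ^+ 3 / 16)); last by field.
  by rewrite ler_wpM2r// divr_ge0// exprn_ge0// ltW.
rewrite cA -/E -/lambda.
apply: (@le_trans _ _ (eta / 4 * ((lambda * density) ^+ 2 * n / (4 * K ^+ 4)))); last first.
  by rewrite ler_pM2l ?divr_gt0.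
have -> : eta / 4 * ((lambda * density) ^+ 2 * n / (4 * K ^+ 4))
   = (eta * (lambda ^+ 2 * density ^+ 2 * n)) / (16 * K ^+ 4).
  by field; rewrite !gt_eqF.
rewrite ler_pdivlMr ?mulr_gt0 ?exprn_gt0// mul1r; apply: le_trans h3 _.
have -> : eta ^+ 3 * lambda ^+ 2 * density ^+ 2 * n =
  eta ^+ 2 * (eta * (lambda ^+ 2 * density ^+ 2 * n)) by ring.
rewrite ler_piMl//; last by rewrite expr_le1 ?ltW//; lra.
by apply: mulr_ge0; [exact: ltW | rewrite mulr_ge0// mulr_ge0 ?sqr_ge0].
Qed.

End FiniteBounds.

(** * Growth of logarithms and powers *)

Section Growth.
Context {R : realType}.
Implicit Types (a K : R).

Lemma near_ln_ge K : \forall N \near \oo, K <= ln (N%:R : R).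
Proof.
near=> N; have h : expR K <= N%:R by near: N; exact: nbhs_infty_ger.
rewrite -[K]expRK ler_ln ?posrE ?expR_gt0//.
by apply: lt_le_trans h; exact: expR_gt0.
Unshelve. all: by end_near. Qed.

Lemma ln_le_powR (x a : R) : 0 < x -> a * ln x <= x `^ a.
Proof.
move=> x0; rewrite -ln_powR; have x1 : 0 < x `^ a by exact: powR_gt0.
by have := ln_le_subr1 x1; lra.
Qed.

Lemma near_powR_ge a K : 0 < a -> \forall N \near \oo, K <= (N%:R : R) `^ a.
Proof.
move=> a0; near=> N; apply: le_trans (ln_le_powR _ _).
  by rewrite mulrC -ler_pdivrMr//; near: N; exact: near_ln_ge.
by near: N; exact: nbhs_infty_gtr.
Unshelve. all: by end_near. Qed.

(** Split the power in two: one factor [N^(a / 2)] bounds [(a / 2) ln N], the other eventually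
    exceeds [(a / 2)^-1]. *)
Lemma near_ln_le_powR a : 0 < a -> \forall N \near \oo, ln (N%:R : R) <= N%:R `^ a.
Proof.
move=> a0; have a2 : 0 < a / 2 by rewrite divr_gt0.
near=> N; have N0 : 0 < N%:R :> R by near: N; exact: nbhs_infty_gtr.
have h1 : (a / 2)^-1 <= N%:R `^ (a / 2) by near: N; exact: near_powR_ge.
have h2 := ln_le_powR (a / 2) N0.
have -> : N%:R `^ a = N%:R `^ (a / 2) * N%:R `^ (a / 2).
  by rewrite -powRD ?gt_eqF ?implybT// -splitr.
have := ler_pM _ _ h1 h2; rewrite mulrA mulVf ?mul1r ?gt_eqF//; apply.
  by rewrite invr_ge0 ltW.
rewrite mulr_ge0 ?ltW// ln_gt0//.
by near: N; exact: nbhs_infty_gtr.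
Unshelve. all: by end_near. Qed.

End Growth.

(** * From dictionaries to asymptotics *)

Section Asymptotics.
Context {R : realType} (S : setting) (k : nat) (k2 : (2 <= k)%N).
Local Notation K := (k%:R : R).

(** [L] bounds the logarithmic size uniformly in [eps], which in both constructions only rescales
    the vectors. *)
Definition has_dictionary (N : nat) (W L : R) : Prop :=
  forall eps : R, 0 < eps ->
  exists (D : finType) (vec : D -> Omega S N -> R),
    (forall z, detectable (ap_vertex (A := Omega S N) k2) eps z -> exists d,
       \sum_a (z a - vec d a) ^+ 2 <= \sum_a z a ^+ 2 - eps ^+ 2 / W * N%:R) /\
    ln (#|D|.+1)%:R <= L.

(** With [eta = 1 / ln N] the coding condition costs [(ln N)^4]: one logarithm from the dictionary
    and three from [eta^3]. The remaining power [1 / 3] absorbs the constants. *)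
Lemma upper_tail_asymptotics_of_dictionary (p delta : nat -> R) (C W C1 : R)
    (X : nat -> R) :
  (forall N, 0 < p N < 1) -> (forall N, 0 < delta N) -> (forall N, delta N <= C) ->
  1 <= W -> 0 < C1 ->
  (\forall N \near \oo, 1 <= X N) ->
  (\forall N \near \oo, has_dictionary N W (C1 * X N * ln N%:R)) ->
  (\forall N \near \oo,
     X N * ln N%:R `^ (13 / 3) <= (delta N * p N ^+ k) ^+ 4 * N%:R) ->
  upper_tail_asymptotics S k p delta.
Proof.
move=> p01 d0 dC W1 C10 X1 dict big; exists (fun N => (ln N%:R)^-1); split.
- apply/cvgrPdist_le => e e0; near=> N; rewrite sub0r normrN.
  have h : e^-1 <= ln (N%:R : R) by near: N; exact: near_ln_ge.
  have l0 : 0 < ln (N%:R : R) by apply: lt_le_trans h; rewrite invr_gt0.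
  by rewrite gtr0_norm ?invr_gt0// -[e]invrK lef_pV2 ?posrE ?invr_gt0.
(* Nonnegativity is required for every [N]; at [N = 0] the value is [0^-1 = 0]. *)
- by case=> [|N]; [rewrite ln0// invr0 | rewrite invr_ge0 ln_ge0// ler1n].
have c0 : 0 < density k :> R by rewrite invr_gt0 mulr_gt0 ?exprn_gt0 ?ltr0n ?(ltnW k2).
have K0 : 0 < K by rewrite ltr0n ltnW.
have W0 : 0 < W by apply: lt_le_trans W1.
have C0 : 0 < C by apply: lt_le_trans (d0 0%N) (dC 0%N).
pose K1 : R := 128 * W * K ^+ 6 / density k ^+ 4 * C1.
pose K2 : R := 2 * (1 + C) * K ^+ 3 / density k.
pose K3 : R := 16 * K ^+ 4 / density k ^+ 2.
have K10 : 0 < K1.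
  apply: mulr_gt0 => //; apply: divr_gt0; last exact: exprn_gt0.
  by apply: mulr_gt0; [exact: mulr_gt0 | exact: exprn_gt0].
near=> N.
have kN : (k <= N)%N by near: N; exact: nbhs_infty_ge.
have l2 : 2 <= ln (N%:R : R) by near: N; exact: near_ln_ge.
have lC : C <= ln (N%:R : R) by near: N; exact: near_ln_ge.
have lK1 : K1 ^+ 3 <= ln (N%:R : R) by near: N; exact: near_ln_ge.
have lt : ln (N%:R : R) <= N%:R `^ 12^-1.
  by near: N; apply: near_ln_le_powR; rewrite invr_gt0.
have t2 : K2 <= N%:R `^ 12^-1 by near: N; apply: near_powR_ge; rewrite invr_gt0.
have t3 : K3 <= N%:R `^ 12^-1 by near: N; apply: near_powR_ge; rewrite invr_gt0.
have XN : 1 <= X N by near: N.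
have [D [vec [step DL]]] : exists (D : finType) (vec : D -> Omega S N -> R),
    (forall z, detectable (ap_vertex (A := Omega S N) k2)
       (error_level k (p N) (delta N) (ln N%:R)^-1) z -> exists d,
       \sum_a (z a - vec d a) ^+ 2 <= \sum_a z a ^+ 2
         - error_level k (p N) (delta N) (ln N%:R)^-1 ^+ 2 / W * N%:R) /\
    ln (#|D|.+1)%:R <= C1 * X N * ln N%:R.
  have h : has_dictionary N W (C1 * X N * ln N%:R) by near: N.
  apply: h; case/andP: (p01 N) => p0 _.
  apply: divr_gt0; last by rewrite mulr_gt0.
  apply: mulr_gt0 => //; apply: mulr_gt0; last by rewrite mulr_gt0 ?exprn_gt0.
  by rewrite invr_gt0 (lt_le_trans _ l2).
have bigN : X N * ln N%:R `^ (13 / 3) <= (delta N * p N ^+ k) ^+ 4 * N%:R by near: N.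
have N0 : 0 < N%:R :> R by rewrite ltr0n (leq_trans _ kN)// ltnW.
(* With [t^12 = N] the other two conditions become polynomial: [lam^4 N >= 1] gives
   [lam^2 N >= t^6], while [ln N] and the constants are at most [t]. *)
set t : R := N%:R `^ 12^-1 in lt t2 t3.
move: l2 lC lK1 lt step DL bigN; set l := ln N%:R => l2 lC lK1 lt step DL bigN.
have l0 : 0 < l by apply: lt_le_trans l2.
have l1 : 1 <= l by apply: le_trans l2; rewrite ler1n.
have t1 : 1 <= t by apply: le_trans lt.
have t0 : 0 < t by apply: lt_le_trans t1.
have tN : t ^+ 12 = N%:R by rewrite -powR_mulrn ?powR_ge0// -powRrM mulVf ?powRr1 ?ltW.
case/andP: (p01 N) => p0 p1.
have [lam lamE] : exists lam, lam = delta N * p N ^+ k by eexists.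
rewrite -lamE in bigN.
have lam0 : 0 < lam by rewrite lamE mulr_gt0// exprn_gt0.
have lamC : lam <= C.
  apply: le_trans (dC N); rewrite lamE ler_piMr ?(ltW (d0 N))//.
  by rewrite exprn_ile1// ltW.
have lp1 : 1 <= l `^ (13 / 3) by rewrite -[leLHS](powRr0 l) ler_powR// divr_ge0.
have lam4 : 1 <= lam ^+ 4 * N%:R.
  by apply: le_trans bigN; rewrite -[leLHS]mulr1 ler_pM.
have lam2 : t ^+ 6 <= lam ^+ 2 * N%:R.
  rewrite -ler_sqr ?nnegrE ?mulr_ge0 ?exprn_ge0 ?(ltW t0) ?(ltW lam0) ?(ltW N0)//.
  rewrite -exprM tN (_ : (lam ^+ 2 * N%:R) ^+ 2 = lam ^+ 4 * N%:R * N%:R); last by ring.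
  by rewrite ler_peMl// ltW.
have lam1 : t ^+ 6 <= lam * N%:R.
  rewrite -ler_sqr ?nnegrE ?mulr_ge0 ?exprn_ge0 ?(ltW t0) ?(ltW lam0) ?(ltW N0)//.
  rewrite -exprM tN (_ : (lam * N%:R) ^+ 2 = lam ^+ 2 * N%:R * N%:R); last by ring.
  rewrite ler_peMl ?(ltW N0)//; apply: le_trans lam2.
  by rewrite exprn_ege1.
apply: (rate_sandwich kN (W := W) (L := C1 * X N * l) _ _ _ _ _ step DL) => //.
- by rewrite invr_gt0 l0 mul1r lef_pV2 ?posrE.
- have le1 : error_level k (p N) (delta N) l^-1 <= 1.
    rewrite /error_level -lamE ler_pdivrMr ?mulr_gt0// mul1r.
    apply: (@le_trans _ _ 1); last first.
      by rewrite -natrM ler1n muln_gt0 (ltnW k2).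
    rewrite -[leRHS]mulr1 ler_pM ?mulr_ge0 ?invr_ge0 ?(ltW l0) ?(ltW lam0) ?(ltW c0)//.
      by rewrite mulrC ler_pdivrMr// mul1r (le_trans lamC).
    rewrite invf_le1 ?mulr_gt0 ?exprn_gt0// -natrX -natrM ler1n muln_gt0 expn_gt0.
    by rewrite (ltnW k2).
  apply: le_trans W1; rewrite expr_le1//.
  apply: divr_ge0; last by rewrite mulr_ge0 ?ltW.
  rewrite -lamE mulr_ge0 ?(ltW c0)// mulr_ge0 ?(ltW lam0)// invr_ge0 ltW//.
- rewrite -lamE.
  have lE : l `^ (13 / 3) = l ^+ 4 * l `^ 3^-1.
    rewrite -powR_mulrn ?(ltW l0)// -powRD ?(gt_eqF l0) ?implybT//.
    by congr (_ `^ _); field.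
  have K1l : K1 <= l `^ 3^-1.
    have -> : K1 = (K1 ^+ 3) `^ 3^-1.
      by rewrite -powR_mulrn ?(ltW K10)// -powRrM mulfV// powRr1 ?ltW.
    by rewrite ge0_ler_powR ?nnegrE ?exprn_ge0 ?(ltW K10) ?(ltW l0).
  apply: (@le_trans _ _ (l^-1 ^+ 3 * (X N * l `^ (13 / 3)))); last first.
    by rewrite -mulrA ler_wpM2l// exprn_ge0// invr_ge0 ltW.
  rewrite lE (_ : l^-1 ^+ 3 * _ = l `^ 3^-1 * (X N * l)); last by field; rewrite gt_eqF.
  rewrite (_ : _ * (C1 * X N * l) = K1 * (X N * l)); last by rewrite /K1; ring.
  by rewrite ler_wpM2r// mulr_ge0 ?(ltW l0)// (le_trans _ XN).
- rewrite -lamE; apply: (@le_trans _ _ (K2 * density k)).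
    rewrite /K2 divfK ?gt_eqF// !ler_wpM2r ?exprn_ge0 ?(ltW K0)//.
    by rewrite ler_wpM2l// lerD2l.
  rewrite (_ : l^-1 * lam * _ * _ = l^-1 * (lam * N%:R) * density k); last by ring.
  rewrite ler_pM2r// mulrC ler_pdivlMr//.
  apply: le_trans lam1; apply: (@le_trans _ _ (t * t)).
    apply: ler_pM => //; rewrite ?(ltW l0)// /K2 divr_ge0 ?(ltW c0)//.
    by rewrite !mulr_ge0 ?exprn_ge0 ?(ltW K0)// addr_ge0// ltW.
  by rewrite -expr2 ler_weXn2l.
rewrite -lamE; apply: (@le_trans _ _ (K3 * density k ^+ 2)).
  by rewrite /K3 divfK// expf_neq0// gt_eqF.
rewrite (_ : l^-1 ^+ 3 * _ * _ * _ = lam ^+ 2 * N%:R / l ^+ 3 * density k ^+ 2); last first.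
  by rewrite exprVn; ring.
rewrite ler_pM2r ?exprn_gt0// ler_pdivlMr ?exprn_gt0//.
apply: le_trans lam2; apply: (@le_trans _ _ (t * t ^+ 3)).
  apply: ler_pM => //; rewrite ?exprn_ge0 ?(ltW l0)//.
    by rewrite /K3 divr_ge0 ?exprn_ge0 ?(ltW c0)// mulr_ge0 ?exprn_ge0 ?(ltW K0).
  by rewrite lerXn2r ?nnegrE ?(ltW l0) ?(ltW t0).
by rewrite -exprS ler_weXn2l.
Unshelve. all: by end_near. Qed.

(* The sample size [m] is of order [N ^ (1 - 1 / (k - 1))]: this is the least order
   for which the second moment of the sampled dual function stays bounded. *)
Definition sampled_gain : R := K ^+ 2 + K ^+ 3 * 2 ^+ k.-1.

(** Taking [B = 2^(k - 1) N] bounds the second moment by [sampled_gain]; [k] samples of [m] points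
    have [(N + 1)^(m k)] values, whose logarithm is of order [m k ln N]. *)
Lemma has_sampled_dictionary N : (2 <= N)%N -> 1 <= ln (N%:R : R) ->
  has_dictionary N sampled_gain
    (8 * K * (N%:R `^ (1 - (K - 1)^-1)) * ln N%:R).
Proof.
move=> N2 l1 eps eps0; set X := N%:R `^ _; set l := ln _ in l1 *.
have k0 : (0 < k)%N by exact: ltnW.
have Np : (0 < N)%N by exact: ltnW.
have N0 : 0 < N%:R :> R by rewrite ltr0n ltnW.
have N1 : 1 <= N%:R :> R by rewrite ler1n ltnW.
have km : K - 1 = k.-1%:R by rewrite -[k in LHS]prednK// -natr1 addrK.
have km0 : 0 < k.-1%:R :> R by rewrite ltr0n -ltnS prednK.
have X1 : 1 <= X.
  rewrite -[leLHS](powRr0 N%:R) ler_powR// subr_ge0 km invf_le1// ler1n -ltnS prednK//.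
have X0 : 0 < X by apply: lt_le_trans X1.
pose m := (Num.trunc X).+1.
have /andP[m1 m2] := trunc_itv (ltW X0).
have mX : m%:R <= 2 * X :> R.
  by rewrite /m -natr1 [leRHS]mulr_natl mulr2n lerD.
have cA : #|{: Omega S N}| = N by rewrite card_Omega// ltnW.
have mB : (1 + #|{: Omega S N}|%:R / m%:R) ^+ k.-1 <= 2 ^+ k.-1 * N%:R :> R.
  (* Then [1 + N / m <= 2 y], and [m >= X] gives [N / m <= N^(1 / (k - 1))], so [y^(k - 1) <= N]. *)
  rewrite cA; pose y := Num.max 1 (N%:R / m%:R) : R.
  have y1 : 1 <= y by rewrite le_max lexx.
  have yk : y ^+ k.-1 <= N%:R.
    rewrite /y maxEle; case: ifP => _; last by rewrite expr1n.
    apply: (@le_trans _ _ ((N%:R / X) ^+ k.-1)).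
      rewrite ler_pXn2r -?lt0n ?nnegrE ?divr_ge0 ?(ltW N0) ?(ltW X0)//.
        by rewrite ler_pM2l// lef_pV2 ?posrE ?ltr0n// ltW.
      by rewrite -ltnS prednK.
    have -> : N%:R / X = N%:R `^ (K - 1)^-1.
      apply: (mulIf (lt0r_neq0 X0)); rewrite divfK ?gt_eqF// -powRD ?(gt_eqF N0) ?implybT//.
      by rewrite addrCA subrr addr0 powRr1 ?(ltW N0).
    rewrite -powR_mulrn ?powR_ge0// -powRrM km mulVf ?(gt_eqF km0)//.
    by rewrite powRr1 ?(ltW N0).
  apply: (@le_trans _ _ ((2 * y) ^+ k.-1)); last by rewrite exprMn ler_wpM2l ?exprn_ge0.
  rewrite lerXn2r ?nnegrE ?addr_ge0 ?divr_ge0 ?mulr_ge0 ?(le_trans _ y1) ?(ltW N0)//.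
  by rewrite [leRHS]mulr_natl mulr2n lerD// le_max lexx orbT.
have V0 : 0 < sampled_gain.
  by rewrite addr_gt0// ?mulr_gt0 ?exprn_gt0 ?ltr0n.
exists ('I_k * bool * {ffun 'I_k -> {ffun 'I_m -> option (Omega S N)}})%type.
exists (sampled_vec (ap_vertex (A := Omega S N) k2) (eps / sampled_gain)); split.
  have A0 : (0 < #|{: Omega S N}|)%N by rewrite cA ltnW.
  have hB : K * (K * #|{: Omega S N}|%:R + K ^+ 2 * (2 ^+ k.-1 * N%:R))
      <= sampled_gain * #|{: Omega S N}|%:R.
    by rewrite cA /sampled_gain le_eqVlt; apply/orP; left; apply/eqP; ring.
  have m0 : (0 < m)%N by [].
  move=> z /(sampled_dictionary (@Omega_codegree S N k k2) k2 m0 A0 mB eps0 V0 hB).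
  by rewrite cA.
rewrite !card_prod card_bool card_ord !card_ffun card_ord card_option card_ord cA.
apply: (@le_trans _ _ (ln ((4 * k * (N ^ 2) ^ (m * k))%N%:R))).
  rewrite ler_ln ?posrE ?ltr0n ?muln_gt0 ?expn_gt0 ?k0 ?Np//.
  rewrite ler_nat -expnM.
  have h : (N.+1 ^ (m * k) <= (N ^ 2) ^ (m * k))%N.
    rewrite leq_exp2r ?muln_gt0 ?k0// -mulnn; apply: (@leq_trans (2 * N)).
      by rewrite mul2n -addnn -addn1 leq_add2l.
    by rewrite leq_mul2r N2 orbT.
  have h1 : (0 < N.+1 ^ (m * k))%N by rewrite expn_gt0.
  move: h h1; set a := (N.+1 ^ _)%N; set b := ((N ^ 2) ^ _)%N => h h1.
  apply: (@leq_trans (4 * k * a)); last by rewrite leq_mul2l h orbT.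
  rewrite (_ : 4 * k * a = k * 2 * a + k * 2 * a)%N; last by rewrite -mulnDl -mulnDr (mulnC 4).
  by rewrite -addn1 leq_add2l !muln_gt0 k0.
have Xl : 1 <= X * l by rewrite -[leLHS]mulr1 ler_pM.
rewrite natrM lnM ?posrE ?ltr0n ?muln_gt0 ?expn_gt0 ?k0 ?Np//.
rewrite (_ : 8 * K * X * l = 4 * K * (X * l) + 4 * K * (X * l)); last by ring.
apply: lerD.
  have k40 : 0 < (4 * k)%N%:R :> R by rewrite ltr0n muln_gt0.
  apply: le_trans (ln_le_subr1 k40) _; rewrite natrM.
  apply: (@le_trans _ _ (4 * K)); first by rewrite gerBl.
  by rewrite ler_peMr// mulr_ge0.
rewrite -expnM natrX lnXn// -[_ *+ _]mulr_natl -/l natrM natrM.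
apply: (@le_trans _ _ (2 * (2 * X * K) * l)).
  by rewrite ler_wpM2r ?(le_trans _ l1)// ler_wpM2l// ler_wpM2r.
by rewrite le_eqVlt; apply/orP; left; apply/eqP; ring.
Qed.

End Asymptotics.

Lemma has_fourier_dictionary (R : realType) (S : setting) (k2 : (2 <= 3)%N) N :
  (1 <= N)%N -> 1 <= ln (N%:R : R) ->
  has_dictionary S k2 N 16 (26 * 1 * ln (N%:R : R)).
Proof.
move=> N1 l1 eps eps0; set l := ln _ in l1 *.
have [M [e [/andP[M0 MN] eM eI emid]]] := Omega_phase S R N1.
have cA : #|{: Omega S N}| = N by exact: card_Omega.
exists ('I_3 * 'I_M * bool * bool)%type, (fourier_vec e (eps / 4)); split.
  have A0 : (0 < #|{: Omega S N}|)%N by rewrite cA.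
  by move=> z /(fourier_dictionary3 M0 A0 eM eI emid eps0); rewrite cA.
rewrite !card_prod !card_bool !card_ord.
have N0 : 0 < N%:R :> R by rewrite ltr0n.
(* The dictionary has [12 M <= 24 N] members, and [ln 25 <= 24] is absorbed as [ln N >= 1]. *)
apply: (@le_trans _ _ (ln (25 * N%:R))).
  rewrite ler_ln ?posrE ?ltr0n ?mulr_gt0// -natrM ler_nat; lia.
rewrite lnM ?posrE// mulr1.
have : ln (25 : R) <= 25 - 1 by exact: ln_le_subr1.
by rewrite -/l; lra.
Qed.

Theorem theorem2p1 (R : realType) (k : nat) (hk : (3 <= k)%N) (S : setting)
    (p delta : nat -> R)
    (p_itv : forall N, 0 < p N < 1)
    (p_away : exists2 c : R, 0 < c & forall N, p N <= 1 - c)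
    (delta_gt0 : forall N, 0 < delta N)
    (delta_bounded : exists C : R, forall N, delta N <= C) :
  [/\ (\forall N \near \oo,
         (N%:R `^ (- (1 / (6 * (k%:R - 1)))) * ln N%:R : R)
           <= Num.min (delta N * p N ^+ k) (delta N ^+ 2 * p N)) ->
      upper_tail_asymptotics S k p delta,
      k = 3%N ->
      (\forall N \near \oo,
         (N%:R `^ (- (1 / 6)) * ln N%:R `^ (7 / 6) : R)
           <= Num.min (delta N * p N ^+ k) (delta N ^+ 2 * p N)) ->
      upper_tail_asymptotics S k p delta &
      k = 4%N ->
      (\forall N \near \oo,
         (N%:R `^ (- (1 / 12)) * ln N%:R `^ (13 / 12) : R)
           <= Num.min (delta N * p N ^+ k) (delta N ^+ 2 * p N)) ->
      upper_tail_asymptotics S k p delta].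
Proof.
have [C dC] := delta_bounded; have k2 : (2 <= k)%N by exact: ltnW.
have K3 : 3 <= k%:R :> R by rewrite ler_nat.
have K1 : 0 < (k%:R - 1 : R) by lra.
have lam0 N : 0 < delta N * p N ^+ k.
  by case/andP: (p_itv N) => p0 _; rewrite mulr_gt0 ?exprn_gt0.
have pow4 (N : nat) (b c : R) : (N%:R `^ b * ln N%:R `^ c)
    <= Num.min (delta N * p N ^+ k) (delta N ^+ 2 * p N) ->
    N%:R `^ (4 * b) * ln N%:R `^ (4 * c) <= (delta N * p N ^+ k) ^+ 4.
  rewrite le_min => /andP[h _].
  have e x (d : R) : x `^ (4 * d) = (x `^ d) ^+ 4.
    by rewrite -powR_mulrn ?powR_ge0// -powRrM mulrC.
  rewrite !e -exprMn lerXn2r// nnegrE; last exact: ltW.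
  by rewrite mulr_ge0 ?powR_ge0.
(* The sampled dictionary, with [X = N^(1 - 1 / (k - 1))]; it serves both the general bound and
   [k = 4]. *)
have general : (\forall N \near \oo,
    N%:R `^ (1 - (k%:R - 1)^-1) * ln N%:R `^ (13 / 3)
      <= (delta N * p N ^+ k) ^+ 4 * N%:R) -> upper_tail_asymptotics S k p delta.
  move=> big; apply: (@upper_tail_asymptotics_of_dictionary _ _ _ k2 _ _ _ (sampled_gain k)
    (8 * k%:R) _ p_itv delta_gt0 dC _ _ _ _ big).
  - rewrite /sampled_gain; apply: (@le_trans _ _ (k%:R ^+ 2)).
      by rewrite exprn_ege1//; lra.
    by rewrite lerDl mulr_ge0 ?exprn_ge0.
  - by rewrite mulr_gt0//; lra.
  - near=> N; have N1 : 1 <= N%:R :> R by near: N; exact: nbhs_infty_ger.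
    by rewrite -[leLHS](powRr0 N%:R) ler_powR// subr_ge0 invf_le1//; lra.
  near=> N; apply: has_sampled_dictionary; near: N; last exact: near_ln_ge.
  exact: nbhs_infty_ge.
split.
(* The fourth power of the hypothesis leaves a spare [N^(1 / (3 (k - 1)))], which pays for the
   missing [(ln N)^(1 / 3)]. *)
- move=> hyp; apply: general; near=> N.
  have N0 : 0 < N%:R :> R by near: N; exact: nbhs_infty_gtr.
  have l1 : 1 <= ln (N%:R : R) by near: N; exact: near_ln_ge.
  have l0 : 0 < ln (N%:R : R) by apply: lt_le_trans l1.
  have lN : ln (N%:R : R) <= N%:R `^ (k%:R - 1)^-1.
    by near: N; apply: near_ln_le_powR; rewrite invr_gt0.
  have h : N%:R `^ (- (1 / (6 * (k%:R - 1)))) * ln N%:R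
      <= Num.min (delta N * p N ^+ k) (delta N ^+ 2 * p N) by near: N.
  rewrite -[X in _ * X <= _](powRr1 (ltW l0)) in h.
  apply: le_trans
    (_ : N%:R `^ (4 * - (1 / (6 * (k%:R - 1)))) * ln N%:R `^ (4 * 1) * N%:R <= _); last first.
    by rewrite ler_wpM2r ?(ltW N0)//; exact: pow4.
  rewrite mulrAC -[X in _ * X * _](powRr1 (ltW N0)) -powRD ?(gt_eqF N0) ?implybT//.
  have -> : 13 / 3 = 3^-1 + 4 * 1 :> R by field.
  rewrite [X in _ * X <= _]powRD ?(gt_eqF l0) ?implybT// mulrA ler_wpM2r ?powR_ge0//.
  apply: (@le_trans _ _ (N%:R `^ (1 - (k%:R - 1)^-1) * (N%:R `^ (k%:R - 1)^-1) `^ 3^-1)).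
    by rewrite ler_wpM2l ?powR_ge0// ge0_ler_powR ?nnegrE ?powR_ge0 ?(ltW l0).
  rewrite -powRrM -powRD ?(gt_eqF N0) ?implybT//.
  by rewrite le_eqVlt; apply/orP; left; apply/eqP; congr (_ `^ _); field; rewrite gt_eqF.
(* The Fourier dictionary has [X = 1], and the hypothesis gives [N^(1 / 3) (ln N)^(14 / 3)], above
   the required [(ln N)^(13 / 3)]. *)
- move=> k3; subst k => hyp.
  apply: (@upper_tail_asymptotics_of_dictionary _ _ _ k2 _ _ _ 16 26 (fun=> 1)
    p_itv delta_gt0 dC); rewrite ?ler1n//.
  - by near=> N.
  - near=> N; apply: has_fourier_dictionary; near: N; last exact: near_ln_ge.
    exact: nbhs_infty_ge.
  near=> N.
  have N1 : 1 <= N%:R :> R by near: N; exact: nbhs_infty_ger.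
  have N0 : 0 < N%:R :> R by apply: lt_le_trans N1.
  have l1 : 1 <= ln (N%:R : R) by near: N; exact: near_ln_ge.
  have h : N%:R `^ (- (1 / 6)) * ln N%:R `^ (7 / 6)
      <= Num.min (delta N * p N ^+ 3) (delta N ^+ 2 * p N) by near: N.
  apply: le_trans
    (_ : N%:R `^ (4 * - (1 / 6)) * ln N%:R `^ (4 * (7 / 6)) * N%:R <= _); last first.
    by rewrite ler_wpM2r ?(ltW N0)//; exact: pow4.
  rewrite mulrAC -[X in _ * X * _](powRr1 (ltW N0)) -powRD ?(gt_eqF N0) ?implybT//.
  apply: ler_pM; rewrite ?powR_ge0//.
    by rewrite -[leLHS](powRr0 N%:R) ler_powR//; lra.
  by rewrite ler_powR//; lra.
(* For [k = 4] the fourth power of the hypothesis, times [N], is exactly the required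
   [N^(2 / 3) (ln N)^(13 / 3)]. *)
move=> k4; subst k => hyp; apply: general; near=> N.
have N0 : 0 < N%:R :> R by near: N; exact: nbhs_infty_gtr.
have h : N%:R `^ (- (1 / 12)) * ln N%:R `^ (13 / 12)
    <= Num.min (delta N * p N ^+ 4) (delta N ^+ 2 * p N) by near: N.
apply: le_trans
    (_ : N%:R `^ (4 * - (1 / 12)) * ln N%:R `^ (4 * (13 / 12)) * N%:R <= _); last first.
  by rewrite ler_wpM2r ?(ltW N0)//; exact: pow4.
rewrite mulrAC -[X in _ * X * _](powRr1 (ltW N0)) -powRD ?(gt_eqF N0) ?implybT//.
rewrite (_ : 1 - (4 - 1)^-1 = 4 * - (1 / 12) + 1 :> R); last by field.
by rewrite (_ : 13 / 3 = 4 * (13 / 12) :> R)//; field.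
Unshelve. all: by end_near. Qed.
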